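(* Let $d\ge 2$ be an integer, and let $P$ and $\mathcal{F}$ denote the paraboloid in $\mathbb F_q^d$ and the flat disk in $\mathbb F_q^{2d}$, respectively. Suppose that $R^*_P(2\to r) \lesssim 1$ for some $\frac{2d}{d-1}\le r\le \infty$. Then we have $$R^*_{\mathcal{F}}\left(\frac{2r(d-1)}{rd-r-2} \to r\right) \lesssim 1,$$ where for $r=\infty$ the exponent $\frac{2r(d-1)}{rd-r-2}$ is read as its limit $2$.
   Context: $\mathbb F_q$ is a finite field with $q$ elements, $q$ odd. The paraboloid is $P:=\{x\in\mathbb F_q^d:\ x_1^2+\cdots+x_{d-1}^2=x_d\}$, and the flat disk is $$\mathcal{F}:=\{(\alpha,\ \alpha\cdot\alpha,\ \beta,\ \alpha\cdot\beta):\ \alpha,\beta\in\mathbb F_q^{d-1}\}\subset \mathbb F_q^{2d},$$ where $\alpha\cdot\beta=\sum_i\alpha_i\beta_i$. The canonical additive character of $\mathbb F_q$ is $\chi(c)=e^{2\pi i\,\mathrm{Tr}(c)/p_0}$, where $p_0$ is the characteristic of $\mathbb F_q$ and $\mathrm{Tr}:\mathbb F_q\to\mathbb F_{p_0}$ is the absolute trace. For a variety $V\subset\mathbb F_q^N$ (here $V=P$, $N=d$, or $V=\mathcal F$, $N=2d$), the normalized surface measure $d\sigma_V$ is $\int_V f\,d\sigma_V=\frac1{|V|}\sum_{x\in V}f(x)$, so $\|f\|_{L^p(V,d\sigma_V)}=\big(\frac1{|V|}\sum_{x\in V}|f(x)|^p\big)^{1/p}$ (maximum of $|f|$ if $p=\infty$).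 The space $(\mathbb F_q^N,dm)$ carries counting measure, so $\|g\|_{L^r(\mathbb F_q^N,dm)}=\big(\sum_m|g(m)|^r\big)^{1/r}$ (maximum if $r=\infty$). For $f:V\to\mathbb C$, $(fd\sigma_V)^\vee(m)=\frac1{|V|}\sum_{x\in V}\chi(x\cdot m)f(x)$ for $m\in\mathbb F_q^N$. For $1\le p,r\le\infty$, $R^*_V(p\to r)$ is the smallest constant such that $\|(fd\sigma_V)^\vee\|_{L^r(\mathbb F_q^N,dm)}\le R^*_V(p\to r)\,\|f\|_{L^p(V,d\sigma_V)}$ for all $f:V\to\mathbb C$. $A\lesssim B$ means $A\le CB$ for a constant $C>0$ independent of $q$ ($C$ may depend on the dimension and the exponents). *)

(* Defs.v *)
From HB Require Import structures.
From mathcomp Require Import all_boot all_order all_algebra all_field.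
From mathcomp Require Import complex.
From mathcomp Require Import all_classical all_reals all_analysis.
Set Implicit Arguments.
Unset Strict Implicit.
Unset Printing Implicit Defensive.
Import Order.TTheory GRing.Theory Num.Theory.
Local Open Scope ring_scope.

Definition fchar (F : finFieldType) : nat := s2val (finPcharP F).

Definition fcharP (F : finFieldType) : fchar F \in [pchar F] :=
  s2valP' (finPcharP F).

(* [pPrimeCharType] is [F] seen as a (Galois) extension of its prime field. *)
Definition abs_trace (F : finFieldType) (c : F) : F :=
  galTrace 1%AS {: pPrimeCharType (fcharP F)}%AS c.

(* [abs_trace] takes its values in the prime subfield, viewed inside [F]; this
   is the corresponding element of ['F_p], so the default [0] is never used. *)
Definition abs_trace_Fp (F : finFieldType) (c : F) : 'F_(fchar F) :=
  odflt 0 [pick k : 'F_(fchar F) | (k : nat)%:R == abs_trace c].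

Definition add_char (R : realType) (F : finFieldType) (c : F) : R[i] :=
  let theta : R := 2 * pi * (abs_trace_Fp c : nat)%:R / (fchar F)%:R in
  Complex (cos theta) (sin theta).

Definition dotv (F : finFieldType) (n : nat) (x y : 'rV[F]_n) : F :=
  \sum_(i < n) x 0 i * y 0 i.

(* The premise [j.+1 == d] selects the last coordinate. *)
Definition paraboloid (d : nat) (F : finFieldType) : {set 'rV[F]_d} :=
  [set x : 'rV[F]_d | [forall j : 'I_d, (j.+1 == d) ==>
     (\sum_(i < d | (i.+1 < d)%N) x 0 i ^+ 2 == x 0 j)]].

(* The vector (a, t) of F^d, for a in F^(d-1) and t in F. *)
Definition append (d : nat) (F : finFieldType) (a : 'rV[F]_(d.-1)) (t : F)
    : 'rV[F]_d :=
  \row_(i < d) oapp (a 0) t (insub (i : nat)).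

Definition flat_disk (d : nat) (F : finFieldType) : {set 'rV[F]_(d + d)} :=
  [set row_mx (@append d F a (dotv a a)) (@append d F b (dotv a b))
     | a : 'rV[F]_(d.-1), b : 'rV[F]_(d.-1)].

(* Functions on a variety V are represented by functions on the ambient space;
   their values outside V are irrelevant to everything below. The exponents
   range over the extended reals; [-oo] is a junk case. *)

Definition surf_norm (R : realType) (F : finFieldType) (N : nat)
    (V : {set 'rV[F]_N}) (p : \bar R) (f : 'rV[F]_N -> R[i]) : R :=
  match p with
  | EFin s => (#|V|%:R^-1 * \sum_(x in V) Normc.normc (f x) `^ s) `^ s^-1
  | +oo%E => \big[Num.max/0]_(x in V) Normc.normc (f x)
  | -oo%E => 0
  end.

Definition count_norm (R : realType) (F : finFieldType) (N : nat)
    (r : \bar R) (g : 'rV[F]_N -> R[i]) : R :=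
  match r with
  | EFin s => (\sum_m Normc.normc (g m) `^ s) `^ s^-1
  | +oo%E => \big[Num.max/0]_m Normc.normc (g m)
  | -oo%E => 0
  end.

Definition extension (R : realType) (F : finFieldType) (N : nat)
    (V : {set 'rV[F]_N}) (f : 'rV[F]_N -> R[i]) (m : 'rV[F]_N) : R[i] :=
  #|V|%:R^-1 * \sum_(x in V) add_char R (dotv x m) * f x.

(* For V nonempty and p, r >= 1 the set of admissible constants is nonempty
   (finite dimension), bounded below by 0 and closed, so that [inf] is its
   least element. *)
Definition ext_const (R : realType) (F : finFieldType) (N : nat)
    (V : {set 'rV[F]_N}) (p r : \bar R) : R :=
  inf [set C : R | forall f : 'rV[F]_N -> R[i],
         count_norm r (extension V f) <= C * surf_norm V p f]%classic.

(* [A] and [B] depend on the finite field F_q (q odd) and the constant does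
   not. *)
Definition lesssim (R : realType) (A B : finFieldType -> R) : Prop :=
  exists2 C : R, 0 < C & forall F : finFieldType, odd #|F| -> A F <= C * B F.

Definition disk_exponent (R : realType) (d : nat) (r : \bar R) : \bar R :=
  match r with
  | EFin s => (2 * s * (d%:R - 1) / (s * d%:R - s - 2))%:E
  | +oo%E => EFin 2
  | -oo%E => -oo%E
  end.

(* Main.v *)
Require Import Defs.
From mathcomp Require Import all_boot all_order all_algebra all_field.
From mathcomp Require Import complex.
From mathcomp Require Import ring lra zify.
From mathcomp Require Import all_classical all_reals all_analysis.
Set Implicit Arguments.
Unset Strict Implicit.
Unset Printing Implicit Defensive.
Import Order.TTheory GRing.Theory Num.Theory.
Local Open Scope ring_scope.

(** Let q be the order of the field and n = d - 1. A frequency in F^(2d) is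
    written as ((xi, s), (eta, t)) with xi and eta in F^n. Summing over the second
    parameter of the disk first, the extension of f at this frequency becomes
    the extension from the paraboloid, at (xi, s), of the function

      a |-> g_a (eta + t a),   g_a (gamma) = q^-n sum_b chi (b . gamma) f (a, b)

    ([extension_flat_disk]). The hypothesis for each (eta, t) therefore bounds the
    r-th power of the norm to be estimated by the sum over (eta, t) of
    H (eta, t) ^ (r / 2), where H (eta, t) is the average over a of
    |g_a (eta + t a)|^2.

    Now H is the adjoint of the X-ray transform applied to |g_a (gamma)|^2, seen
    as a weight on the line of the points (gamma - t a, t), which has direction
    given by a. By duality its norm is governed by the Kakeya maximal function,
    which takes in each direction the largest sum over a line. The inequality
    [kakeya_maximal] bounds that function from L^d to L^d uniformly in q, and
    Hoelder's inequality on single lines gives all the other exponents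
    ([sum_xray_adj_le]); this is where r >= 2 d / (d - 1) is used. What remains
    on the right-hand side is a mixed norm of g, of exponent 2 in gamma and p in
    a. Plancherel's identity in b turns it into a mixed norm of f with exponents 2
    and p, and p >= 2 makes the L^p norm of f at least as large.

    The Kakeya maximal inequality comes from the polynomial method with
    multiplicities. Let a weight m on F^d take natural values, and choose a line
    in each direction. There is room for a polynomial that vanishes to order
    m (x) at each x as soon as the number of available monomials exceeds the sum
    of m (x) ^ d. If a line has mass well above the degree, the top form of the
    polynomial vanishes to high order at its direction
    ([hasse_top_form_eq0]). Conversely, for a set A of directions there are many
    monomials no combination of which vanishes to high order on A: a proportion
    |A| / q^n of all of them, by an averaging argument over the translates of A
    ([independent_monomials]). Choosing such monomials in each degree, with A the
    directions whose lines are heavy for that degree, leads to a contradiction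
    unless the weighted number of heavy directions is at most q^n times the sum
    of m (x) ^ d ([kakeya_count]), which is the strong-type inequality for m. *)

(** * Roots with multiplicity and Hasse derivatives *)

Section Univ.
Variable F : finFieldType.

Lemma dvdp_prod_XsubC_exp (k : F -> nat) (p : {poly F}) :
  (forall t, ('X - t%:P) ^+ k t %| p) -> \prod_t ('X - t%:P) ^+ k t %| p.
Proof.
move=> kp.
suff: forall s : seq F, uniq s -> \prod_(t <- s) ('X - t%:P) ^+ k t %| p.
  by apply; exact: index_enum_uniq.
elim=> [|t s IHs] /=; first by rewrite big_nil dvd1p.
case/andP=> ts us; rewrite big_cons Gauss_dvdp ?kp ?IHs //.
apply: coprimep_expl.
have: all (fun u => coprimep ('X - t%:P) (('X - u%:P) ^+ k u)) s.
  apply/allP => u us'; apply: coprimep_expr; rewrite coprimep_XsubC root_XsubC.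
  by apply: contra ts => /eqP E; move: us'; rewrite E.
elim: (s) => [|u s' IH] /=; first by rewrite big_nil coprimep1.
by case/andP=> h1 h2; rewrite big_cons coprimepMr h1 IH.
Qed.

Lemma poly_eq0_roots (k : F -> nat) (p : {poly F}) :
  (forall t, ('X - t%:P) ^+ k t %| p) -> (size p <= \sum_t k t)%N -> p = 0.
Proof.
move=> kp sp; apply/eqP; apply: contraTT sp => p0; rewrite -ltnNge.
have := dvdp_leq p0 (dvdp_prod_XsubC_exp kp).
rewrite size_prod; last by move=> t _; rewrite expf_neq0 // polyXsubC_eq0.
under eq_bigr => t _ do rewrite size_exp_XsubC.
under eq_bigr => t _ do rewrite -addn1.
rewrite big_split /= sum1_card.
by rewrite -addSn addnK.
Qed.

Lemma dvdp_XsubC_shift (t : F) (k : nat) (p : {poly F}) :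
  (forall j, (j < k)%N -> (p \Po ('X + t%:P))`_j = 0) -> ('X - t%:P) ^+ k %| p.
Proof.
move=> h.
have e : p = (p \Po ('X + t%:P)) \Po ('X - t%:P).
  by rewrite -comp_polyA comp_polyD comp_polyX comp_polyC subrK comp_polyXr.
have d : 'X^k %| p \Po ('X + t%:P).
  rewrite dvdp_eq; apply/eqP; set p' := p \Po _ in h *.
  rewrite {1}(divp_eq p' 'X^k) (_ : p' %% 'X^k = 0) ?addr0 //.
  have {1}-> : p' = drop_poly k p' * 'X^k + take_poly k p'.
    by rewrite addrC poly_take_drop.
  rewrite modpD modp_mull add0r (_ : take_poly k p' = 0) ?mod0p //.
  by apply/polyP => j; rewrite coef_take_poly coef0; case: ltnP => // /h.
rewrite e; have := dvdp_comp_poly ('X - t%:P) d.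
by rewrite comp_Xn_poly.
Qed.

End Univ.

Section Hasse.
Variable R : comNzRingType.

(** The Hasse derivative of order [i] of [X ^ e] at [x]. Unlike iterated ordinary
    derivatives, these coefficients detect vanishing orders in characteristic p
    as well, since they are the Taylor coefficients of [X ^ e] at [x]. *)
Definition hasse_coef (e i : nat) (x : R) : R := x ^+ (e - i) *+ 'C(e, i).

Lemma expr_hasse N (e : nat) (x y : R) : (e < N)%N ->
  (x + y) ^+ e = \sum_(i < N) hasse_coef e i x * y ^+ i.
Proof.
move=> eN; rewrite exprDn (big_ord_widen _ (fun i => x ^+ (e - i) * y ^+ i *+ 'C(e, i)) eN).
rewrite big_mkcond; apply: eq_bigr => i _; rewrite /hasse_coef mulrnAl.
by case: ltnP => // ei; rewrite bin_small // mulr0n.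
Qed.

Lemma bin_trinomial (e i j : nat) :
  ('C(e, i) * 'C(e - i, j) = 'C(e, i + j) * 'C(i + j, i))%N.
Proof.
have [le|lt] := leqP (i + j) e; last first.
  rewrite (bin_small lt) mul0n; have [|h] := ltnP e i; first by move/bin_small->.
  by rewrite (@bin_small (e - i)) ?muln0 // ltn_subLR.
have h : (0 < i`! * j`! * (e - (i + j))`!)%N by rewrite !muln_gt0 !fact_gt0.
apply/eqP; rewrite -(eqn_pmul2r h).
have ie : (i <= e)%N by apply: leq_trans le; rewrite leq_addr.
have je : (j <= e - i)%N by rewrite leq_subRL.
have E1 := bin_fact ie; have E2 := bin_fact je; have E3 := bin_fact le.
have E4 := bin_fact (leq_addr j i); rewrite addKn in E4.
rewrite -subnDA in E2.
apply/eqP; transitivity e`!.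
  by rewrite -E1 -E2; ring.
by rewrite -E3 -E4; ring.
Qed.

(** Taylor expansion of a Hasse derivative: its Taylor coefficients are binomial
    multiples of higher Hasse derivatives, so a derivative of order [i] loses
    only [i] from the vanishing order. *)
Lemma hasse_coef_shift N (e i : nat) (x y : R) : (e < N)%N ->
  hasse_coef e i (x + y) =
  \sum_(j < N) hasse_coef e (i + j) x * (y ^+ j *+ 'C(i + j, i)).
Proof.
move=> eN; rewrite /hasse_coef (@expr_hasse N) ?(leq_ltn_trans (leq_subr _ _)) //.
rewrite -sumrMnl; apply: eq_bigr => j _; rewrite /hasse_coef subnDA.
rewrite mulrnAl mulrnAr mulrnAl -!mulrnA; congr (_ *+ _).
by rewrite mulnC bin_trinomial mulnC.
Qed.

(** The expansion that expresses jets at a translated point through jets at the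
    original one: translation acts on polynomials of degree [< N] by the matrix
    of entries [hasse_coef e j y]. *)
Lemma hasse_coef_comp N (e i : nat) (x y : R) : (e < N)%N ->
  hasse_coef e i (x + y) = \sum_(j < N) hasse_coef e j y * hasse_coef j i x.
Proof.
move=> eN; rewrite addrC (@hasse_coef_shift N) //.
pose G j := hasse_coef e j y * hasse_coef j i x.
rewrite -(big_mkord xpredT (fun j => G j)).
transitivity (\sum_(0 <= j < N) G (j + i)%N).
  rewrite big_mkord; apply: eq_bigr => j _.
  by rewrite /G (addnC j) {3}/hasse_coef addKn.
have G0 j : (j < i)%N || (e < j)%N -> G j = 0.
  by rewrite /G /hasse_coef; case/orP=> h; rewrite (bin_small h) mulr0n ?mulr0 ?mul0r.
transitivity (\sum_(0 <= j < N + i) G j).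
  rewrite [RHS](@big_cat_nat _ _ _ i) ?leq_addl //= [X in _ = X + _]big_nat_cond.
  rewrite [X in _ = X + _]big1 ?add0r => [|j /andP[/andP[_ ji] _]]; last first.
    by rewrite G0 // ji.
  by rewrite -[X in \sum_(X <= _ < _ + _) _]add0n big_addn addnK.
rewrite (@big_cat_nat _ _ _ N) ?leq_addr //= [X in _ + X]big_nat_cond.
rewrite [X in _ + X]big1 ?addr0 ?big_mkord // => j /andP[/andP[Nj _] _].
by rewrite G0 // (leq_trans eN Nj) orbT.
Qed.

Definition hasse_mon D (e i : 'I_D -> nat) (x : 'I_D -> R) : R :=
  \prod_l hasse_coef (e l) (i l) (x l).

Lemma hasse_mon_eq0 D (e i : 'I_D -> nat) (x : 'I_D -> R) l :
  (e l < i l)%N -> hasse_mon e i x = 0.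
Proof. by move=> h; rewrite /hasse_mon (bigD1 l) //= /hasse_coef bin_small // mulr0n mul0r. Qed.

End Hasse.

Section LineTop.
Variable F : finFieldType.

Lemma coefM_top (p q : {poly F}) a b : (size p <= a.+1)%N -> (size q <= b.+1)%N ->
  (p * q)`_(a + b) = p`_a * q`_b.
Proof.
move=> sp sq; rewrite coefM.
have ha : (a < (a + b).+1)%N by rewrite ltnS leq_addr.
rewrite (bigD1 (Ordinal ha)) //= addKn big1 ?addr0 // => j /eqP ja.
have [ltja|leja] := ltnP j a.
  by rewrite [q`__]nth_default ?mulr0 // (leq_trans sq) //; lia.
rewrite [p`__]nth_default ?mul0r // (leq_trans sp) // ltn_neqAle leja andbT.
by apply: contra_notN ja => /eqP aj; apply/val_inj.
Qed.

Lemma prod_affine_top D (x v : 'I_D -> F) (k : 'I_D -> nat) :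
  let p := \prod_l ((x l)%:P + (v l)%:P * 'X) ^+ k l in
  (size p <= (\sum_l k l).+1)%N /\ p`_(\sum_l k l) = \prod_l v l ^+ k l.
Proof.
move=> p; rewrite /p.
pose P (p : {poly F}) n a := (size p <= n.+1)%N /\ p`_n = a.
have PM p1 n1 a1 p2 n2 a2 : P p1 n1 a1 -> P p2 n2 a2 -> P (p1 * p2) (n1 + n2)%N (a1 * a2).
  move=> [s1 <-] [s2 <-]; split; last exact: coefM_top.
  apply: leq_trans (size_polyMleq _ _) _.
  by move: s1 s2; lia.
have P1 : P 1 0%N 1 by rewrite /P size_poly1 coef1.
rewrite -/(P _ _ _); apply: (big_rec3 (fun a n p => P p n a)) => // l a n q _ IH.
apply: (PM) => //; elim: (k l) => [|j IHj]; first by rewrite !expr0.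
rewrite !exprS -add1n; apply: PM => //; split.
  apply: leq_trans (size_polyD _ _) _; rewrite geq_max.
  apply/andP; split; first by rewrite (leq_trans (size_polyC_leq1 _)).
  by rewrite mulrC (leq_trans (size_polyMleq _ _)) // size_polyX /=  ltnS size_polyC_leq1.
by rewrite coefD coefC add0r coefCM coefX mulr1.
Qed.

Variables (D : nat) (B : finType) (ex : B -> 'I_D -> nat) (c : B -> F).

Definition hasse_deriv (i : 'I_D -> nat) (x : 'I_D -> F) : F :=
  \sum_b c b * hasse_mon (ex b) i x.

(** Vanishing on a line passes to the point at infinity of that line. The
    derivative of order [i] of the polynomial vanishes at the point of parameter
    [t] to order [m t - |i|]; if these orders add up to more than the degree, its
    restriction to the line is zero, and the leading coefficient of that
    restriction is the derivative of the top homogeneous part at the direction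
    [v]. *)
Lemma hasse_top_form_eq0 (x v : 'I_D -> F) (m : F -> nat) (K : nat) (i : 'I_D -> nat) :
  (forall t (j : 'I_D -> nat), (\sum_l j l < m t)%N ->
     hasse_deriv j (fun l => x l + t * v l) = 0) ->
  (forall b, c b != 0 -> (\sum_l ex b l <= K)%N) ->
  (K < \sum_t (m t - \sum_l i l))%N ->
  \sum_(b | \sum_l ex b l == K) c b * hasse_mon (ex b) i v = 0.
Proof.
move=> van degK ltK.
pose pt l : {poly F} := (x l)%:P + (v l)%:P * 'X.
pose Q : {poly F} := \sum_b (c b)%:P * hasse_mon (ex b) i pt.
have hasse_monE b : hasse_mon (ex b) i pt =
    (\prod_l pt l ^+ (ex b l - i l)) * (\prod_l ('C(ex b l, i l))%:R%:P).
  rewrite -big_split; apply: eq_bigr => l _; rewrite /hasse_coef -mulr_natr.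
  by rewrite polyC_natr.
have sizeQ : (size Q <= K.+1)%N.
  apply: (leq_trans (size_sum _ _ _)); apply/bigmax_leqP => b _.
  have [->|cb] := eqVneq (c b) 0; first by rewrite mul0r size_poly0.
  rewrite mul_polyC (leq_trans (size_scale_leq _ _)) // hasse_monE.
  rewrite -rmorph_prod mulrC mul_polyC (leq_trans (size_scale_leq _ _)) //.
  apply: leq_trans (proj1 (prod_affine_top _ _ _)) _; rewrite ltnS.
  apply: leq_trans (degK b cb); apply: leq_sum => l _; exact: leq_subr.
have Q0 : Q = 0.
  apply: (poly_eq0_roots (k := fun t => (m t - \sum_l i l)%N)); last exact: leq_trans sizeQ ltK.
  move=> t; apply: dvdp_XsubC_shift => j jm.
  pose N := (\max_b \max_l ex b l).+1.
  have exN b l : (ex b l < N)%N.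
    by rewrite ltnS (leq_trans _ (leq_bigmax b)) // (leq_bigmax (F := ex b)).
  pose y l := x l + t * v l.
  (* Each factor is expanded around [x + t v]; the coefficient of [X ^ |k|]
     is a multiple of the derivative of order [i + k]. *)
  have E : Q \Po ('X + t%:P) = \sum_(k : {ffun 'I_D -> 'I_N})
      (hasse_deriv (fun l => i l + k l)%N y *
         \prod_l (v l ^+ k l *+ 'C(i l + k l, i l))) *: 'X^(\sum_l k l).
    rewrite /hasse_deriv.
    under [RHS]eq_bigr => k _ do rewrite mulr_suml scaler_suml.
    rewrite exchange_big /Q raddf_sum; apply: eq_bigr => b _ /=.
    rewrite comp_polyM comp_polyC rmorph_prod.
    have H l : (hasse_coef (ex b l) (i l) (pt l) \Po ('X + t%:P)) =
       \sum_(k < N) (hasse_coef (ex b l) (i l + k) (y l) * (v l ^+ k *+ 'C(i l + k, i l))) *: 'X^k.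
      rewrite /hasse_coef rmorphMn rmorphXn /= -/(hasse_coef _ _ _).
      have -> : pt l \Po ('X + t%:P) = (y l)%:P + (v l)%:P * 'X.
        rewrite /pt /y comp_polyD comp_polyM !comp_polyC comp_polyX polyCD polyCM.
        by rewrite mulrDr addrA -addrA [_ * 'X + _]addrC addrA [t%:P * _]mulrC.
      rewrite (hasse_coef_shift _ _ _ (exN b l)); apply: eq_bigr => k _.
      rewrite /hasse_coef exprMn -!polyC_exp.
      by rewrite -mul_polyC polyCM !polyCMn -[_ * 'X^k *+ _]mulrnAl mulrA.
    under eq_bigr => l _ do rewrite /= H.
    rewrite bigA_distr_bigA mulr_sumr; apply: eq_bigr => k _.
    rewrite scaler_prod -expr_sum -mul_polyC mulrA -polyCM mul_polyC -mulrA.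
    by rewrite big_split.
  rewrite E coef_sum big1 // => k _; rewrite coefZ coefXn.
  case: eqP => [jk|]; last by rewrite mulr0.
  rewrite [hasse_deriv _ _]van ?mul0r // big_split /= -jk.
  by move: jm; rewrite ltn_subRL.
(* Only the monomials of degree [K] reach the coefficient of [X ^ (K - |i|)];
   when [|i| > K] all their Hasse derivatives vanish, so that the truncated
   subtraction does no harm. *)
have := congr1 (fun p : {poly F} => p`_(K - \sum_l i l)) Q0.
rewrite coef0 coef_sum => Qc; rewrite -[RHS]Qc big_mkcond; apply: eq_bigr => b _.
rewrite coefCM; have [->|cb] := eqVneq (c b) 0; first by rewrite !mul0r if_same.
have [le|] := boolP [forall l, (i l <= ex b l)%N]; last first.
  rewrite negb_forall => /existsP[l]; rewrite -ltnNge => lt.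
  by rewrite !(hasse_mon_eq0 _ lt) coef0 mulr0 if_same.
move/forallP in le.
have S := @sumnB _ (index_enum _) xpredT i (ex b) (fun l _ => le l).
have Sle : (\sum_l i l <= \sum_l ex b l)%N by apply: leq_sum.
rewrite hasse_monE -rmorph_prod /= coefMC.
have [sz top] := prod_affine_top x v (fun l => ex b l - i l)%N.
case: eqP => [eK|neK].
  rewrite -eK -S top; congr (_ * _).
  by rewrite -big_split; apply: eq_bigr => l _; rewrite /hasse_coef /= mulr_natr.
rewrite [(\prod_l pt l ^+ _)`_ _]nth_default ?mul0r ?mulr0 //.
apply: leq_trans sz _; rewrite S ltn_sub2r //.
  by rewrite (leq_ltn_trans Sle) // ltn_neqAle degK // andbT; apply/eqP.
by rewrite ltn_neqAle degK // andbT; apply/eqP.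
Qed.

End LineTop.

(** * Independent jets of polynomials on a set of points *)

Section Jets.
Variable F : finFieldType.

(** Hermite interpolation in one variable: a polynomial of degree at most [a]
    that vanishes to order [J] at all points of [F] has more zeros than its degree
    allows, so the matrix of jets has a right inverse. Tensor powers of this
    inverse take care of several variables. *)
Lemma hermite_inverse (a J : nat) : (a < #|F| * J)%N ->
  exists K : F * 'I_J -> 'I_a.+1 -> F, forall e e' : 'I_a.+1,
    \sum_(g : F * 'I_J) hasse_coef e g.2 g.1 * K g e' = (e == e')%:R.
Proof.
move=> aJ.
pose T : finType := (F * 'I_J)%type.
pose H : 'M[F]_(a.+1, #|T|) :=
  \matrix_(e, g) hasse_coef e (enum_val g : T).2 (enum_val g : T).1.
have : row_free H.
  apply: inj_row_free => u uH.
  pose p : {poly F} := \sum_e (u 0 e)%:P * 'X^e.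
  suff p0 : p = 0.
    apply/rowP => e; rewrite mxE.
    have := congr1 (fun p : {poly F} => p`_e) p0.
    rewrite coef0 coef_sum (bigD1 e) //= coefCM coefXn eqxx mulr1 big1 ?addr0 // => i ie.
    by rewrite coefCM coefXn eq_sym (inj_eq val_inj) (negPf ie) mulr0.
  apply: (poly_eq0_roots (k := fun=> J)) => [t|]; last first.
    rewrite sum_nat_const (leq_trans _ aJ) //.
    apply: (leq_trans (size_sum _ _ _)); apply/bigmax_leqP => e _.
    rewrite mul_polyC (leq_trans (size_scale_leq _ _)) // size_polyXn.
    exact: ltn_ord.
  apply: dvdp_XsubC_shift => j jJ.
  have := congr1 (fun M : 'rV_ _ => M 0 (enum_rank ((t, Ordinal jJ) : T))) uH.
  rewrite !mxE => h; rewrite -[RHS]h /p raddf_sum coef_sum; apply: eq_bigr => e _ /=.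
  rewrite mxE enum_rankK comp_polyM comp_polyC comp_Xn_poly coefCM; congr (_ * _).
  rewrite addrC (@expr_hasse _ (a.+1 + J)) ?ltn_addr // coef_sum.
  have jN : (j < a.+1 + J)%N by rewrite ltn_addl.
  have E i : hasse_coef e i t%:P * 'X^i = (hasse_coef e i t)%:P * 'X^i.
    by rewrite /hasse_coef polyCMn polyC_exp.
  rewrite (bigD1 (Ordinal jN)) //= E coefCM coefXn eqxx mulr1 big1 ?addr0 // => i ij.
  by rewrite E coefCM coefXn (_ : (j == i) = false) ?mulr0 // eq_sym; apply/negbTE.
case/row_freeP => K HK; exists (fun g e' => K (enum_rank (g : T)) e') => e e'.
have := congr1 (fun M : 'M[F]_a.+1 => M e e') HK; rewrite !mxE => <-.
rewrite [RHS](reindex _ (onW_bij _ (@enum_rank_bij T))) /=.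
by apply: eq_bigr => g _; rewrite mxE enum_rankK.
Qed.

Variables (n a J : nat).
Hypothesis aJ : (a < #|F| * J)%N.

Let E : finType := {ffun 'I_n -> 'I_a.+1}.
Let G : finType := {ffun 'I_n -> F * 'I_J}.

(** A function [g] encodes a point [l |-> (g l).1] of F^n together with a
    multi-order [l |-> (g l).2] all of whose entries are less than [J]. *)
Definition jet_point (g : {ffun 'I_n -> F * 'I_J}) : 'rV[F]_n := \row_l (g l).1.

Definition jet (e : {ffun 'I_n -> 'I_a.+1}) (g : {ffun 'I_n -> F * 'I_J}) : F :=
  \prod_l hasse_coef (e l) (g l).2 (g l).1.

(** The rows that belong to points outside [A] are kept as zero rows, so that the
    matrices for different sets have the same format. *)
Definition jetmx (A : {set 'rV[F]_n}) : 'M[F]_(#|G|, #|E|) :=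
  \matrix_(g, e) (if jet_point (enum_val g) \in A then jet (enum_val e) (enum_val g) else 0).

Lemma rank_jetmxT : \rank (jetmx [set: 'rV[F]_n]%SET) = #|E|.
Proof.
have [K HK] := hermite_inverse aJ.
rewrite -mxrank_tr; apply/eqP; rewrite -/(row_free _); apply/row_freeP.
exists (\matrix_(g, e) \prod_l K ((enum_val g : G) l) ((enum_val e : E) l)).
apply/matrixP => i j; rewrite !mxE.
transitivity (\sum_(g : G) jet (enum_val i) g * \prod_l K (g l) ((enum_val j : E) l)).
  rewrite [RHS](reindex _ (onW_bij _ (@enum_val_bij G))) /=.
  by apply: eq_bigr => g _; rewrite !mxE finset.in_setT.
under eq_bigr => g _ do rewrite /jet -big_split /=.
rewrite -(bigA_distr_bigA (fun l (g : F * 'I_J) =>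
  hasse_coef ((enum_val i : E) l) g.2 g.1 * K g ((enum_val j : E) l))).
under eq_bigr => l _ do rewrite HK.
have [<-|neq] := eqVneq i j; first by rewrite big1 // => l _; rewrite eqxx.
have [l ll] : exists l, (enum_val i : E) l != (enum_val j : E) l.
  apply/existsP; rewrite -negb_forall; apply: contraNN neq => /forallP h.
  by apply/eqP/enum_val_inj/ffunP => l; apply/eqP.
by rewrite (bigD1 l) //= (negPf ll) mul0r.
Qed.

Lemma rowsub_free m1 m2 k (f : 'I_m2 -> 'I_m1) (M : 'M[F]_(m1, k)) :
  injective f -> row_free M -> row_free (rowsub f M).
Proof.
move=> injf freeM; apply/row_freeP; have [B MB] := row_freeP freeM.
exists (B *m (rowsub f 1%:M)^T); rewrite mulmxA mul_rowsub_mx MB mul_rowsub_mx mul1mx.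
by apply/matrixP => i j; rewrite !mxE (inj_eq injf) eq_sym.
Qed.

(** Polynomials of bounded degree in each variable are stable under translation,
    and the jets at [x] of a polynomial are the jets at [x - w] of its
    translate. *)
Lemma rank_jetmx_shift (A : {set 'rV[F]_n}) (w : 'rV[F]_n) :
  (\rank (jetmx [set x : 'rV[F]_n | (x - w)%R \in A]) <= \rank (jetmx A))%N.
Proof.
pose sh (g : G) : G := [ffun l => ((g l).1 - w 0 l, (g l).2)].
pose U : 'M[F]_(#|E|) :=
  \matrix_(e, e') \prod_l hasse_coef ((enum_val e' : E) l) ((enum_val e : E) l) (w 0 l).
suff -> : jetmx [set x : 'rV[F]_n | (x - w)%R \in A] =
    rowsub (fun i => enum_rank (sh (enum_val i))) (jetmx A) *m U.
  by apply: leq_trans (mxrankM_maxl _ _) _; exact: mxrankS (rowsub_sub _ _).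
apply/matrixP => g e; rewrite !mxE inE.
have -> : jet_point (enum_val g) - w = jet_point (sh (enum_val g)).
  by apply/rowP => l; rewrite !mxE ffunE.
under eq_bigr => e' _ do rewrite !mxE enum_rankK.
case: ifP => _; last by rewrite big1 // => e' _; rewrite mul0r.
transitivity (\sum_(e' : E) jet e' (sh (enum_val g)) *
    \prod_l hasse_coef ((enum_val e : E) l) (e' l) (w 0 l)).
  under [RHS]eq_bigr => e' _ do rewrite /jet -big_split /=.
  rewrite -(bigA_distr_bigA (fun l (k : 'I_a.+1) =>
      hasse_coef k (sh (enum_val g) l).2 (sh (enum_val g) l).1 *
      hasse_coef ((enum_val e : E) l) k (w 0 l))).
  apply: eq_bigr => l _; rewrite ffunE /=.
  rewrite -{1}(subrK (w 0 l) (enum_val g l).1) (@hasse_coef_comp _ a.+1) //.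
  by apply: eq_bigr => k _; rewrite mulrC.
by rewrite (reindex _ (onW_bij _ (@enum_val_bij E))).
Qed.

(** Among the jets at all points of F^n some [a.+1 ^ n] form a basis of the dual
    space. On average over [w], the translate of [A] by [w] contains the base
    points of a proportion [#|A| / #|F| ^ n] of that basis, which gives
    independent jets; the rank does not depend on the translate. *)
Lemma rank_jetmx (A : {set 'rV[F]_n}) :
  (#|A| * a.+1 ^ n <= \rank (jetmx A) * #|F| ^ n)%N.
Proof.
pose r := \rank (jetmx [set: 'rV[F]_n]%SET).
pose f : 'I_r -> 'I_#|G| := maxrankfun (jetmx [set: 'rV[F]_n]%SET).
have ff : row_free (rowsub f (jetmx [set: 'rV[F]_n]%SET)) by exact: maxrowsub_free.
pose pt i := jet_point (enum_val (f i)).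
pose S w := [set i | pt i - w \in A].
have Sr w : (#|S w| <= \rank (jetmx A))%N.
  apply: leq_trans (rank_jetmx_shift A w).
  pose h (i : 'I_#|S w|) := enum_val i.
  have free : row_free (rowsub h (rowsub f (jetmx [set: 'rV[F]_n]%SET))).
    by apply: rowsub_free => //; exact: enum_val_inj.
  rewrite -(eqP free).
  suff -> : rowsub h (rowsub f (jetmx [set: 'rV[F]_n]%SET)) =
      rowsub (f \o h) (jetmx [set x : 'rV[F]_n | (x - w)%R \in A]).
    exact: mxrankS (rowsub_sub _ _).
  apply/matrixP => i j; rewrite !mxE finset.in_setT inE.
  by have := enum_valP i; rewrite inE => ->.
have -> : (#|F| ^ n = #|'rV[F]_n|)%N by rewrite card_mx mul1n.
have <- : (r = a.+1 ^ n)%N by rewrite /r rank_jetmxT card_ffun !card_ord.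
have -> : (#|A| * r = \sum_w #|S w|)%N.
  under eq_bigr => w _ do rewrite -sum1_card big_mkcond.
  rewrite exchange_big /= (eq_bigr (fun=> #|A|)) ?sum_nat_const ?card_ord 1?mulnC //.
  move=> i _; rewrite -sum1_card [RHS]big_mkcond /=.
  rewrite [RHS](reindex (fun w : 'rV[F]_n => (pt i - w)%R)) /=.
    by apply: eq_bigr => w _; rewrite inE.
  by exists (fun w : 'rV[F]_n => (pt i - w)%R) => w _; rewrite opprB addrC subrK.
by rewrite mulnC -sum_nat_const; apply: leq_sum.
Qed.

(** The rank bound, read as the choice of a large set of monomials on which the
    jets at [A] are jointly injective. *)
Lemma independent_monomials (A : {set 'rV[F]_n}) :
  exists2 S : {set {ffun 'I_n -> 'I_a.+1}},
    (#|A| * a.+1 ^ n <= #|S| * #|F| ^ n)%N &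
    forall c : {ffun 'I_n -> 'I_a.+1} -> F,
      (forall e, e \notin S -> c e = 0) ->
      (forall g, jet_point g \in A -> \sum_e c e * jet e g = 0) ->
      forall e, c e = 0.
Proof.
pose M := (jetmx A)^T.
pose f : 'I_(\rank M) -> 'I_#|E| := maxrankfun M.
have injf : injective f by exact: maxrankfun_inj.
exists [set enum_val (f i) | i : 'I_(\rank M)].
  rewrite card_imset; last by move=> i j /enum_val_inj /injf.
  by rewrite card_ord mxrank_tr; exact: rank_jetmx.
move=> c cS cA e.
have [|/cS//] := boolP (e \in [set enum_val (f i) | i : 'I_(\rank M)]).
case/imsetP => i _ ->.
pose u : 'rV_(\rank M) := \row_i c (enum_val (f i)).
suff u0 : u = 0.
  by have := congr1 (fun u : 'rV_ _ => u 0 i) u0; rewrite !mxE.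
apply/eqP; rewrite -(mulmx_free_eq0 _ (maxrowsub_free M)); apply/eqP/rowP => g.
rewrite !mxE.
have [gA|gA] := boolP (jet_point (enum_val g) \in A); last first.
  by rewrite big1 // => k _; rewrite !mxE (negPf gA) mulr0.
rewrite -[RHS](cA _ gA) (bigID [in [set enum_val (f i) | i : 'I_(\rank M)]]) /=.
rewrite [X in _ = _ + X]big1 ?addr0; last by move=> k /cS ->; rewrite mul0r.
rewrite big_imset /=; last by move=> k l _ _ /enum_val_inj /injf.
by apply: eq_bigr => k _; rewrite !mxE gA.
Qed.

End Jets.

(** * The polynomial method for weighted lines *)

Definition snoc (n : nat) (T : Type) (x : 'I_n -> T) (t : T) (i : 'I_n.+1) : T :=
  oapp x t (insub (i : nat)).

Lemma snoc_widen n T (x : 'I_n -> T) t (i : 'I_n) :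
  snoc x t (widen_ord (leqnSn n) i) = x i.
Proof. by rewrite /snoc /= valK. Qed.

Lemma snoc_max n T (x : 'I_n -> T) t : snoc x t ord_max = t.
Proof. by rewrite /snoc insubF //= ltnn. Qed.

Lemma sum_snoc n (x : 'I_n -> nat) t : (\sum_l snoc x t l = \sum_l x l + t)%N.
Proof.
rewrite big_ord_recr /= snoc_max; congr addn.
by apply: eq_bigr => l _; rewrite snoc_widen.
Qed.

Lemma exists_kernel (F : fieldType) (B C : finType) (lam : C -> B -> F) (S : {set B}) :
  (#|C| < #|S|)%N ->
  exists c : B -> F, [/\ exists b, c b != 0, forall b, b \notin S -> c b = 0 &
    forall k, \sum_b c b * lam k b = 0].
Proof.
move=> lt.
pose M : 'M[F]_(#|S|, #|C|) := \matrix_(i, k) lam (enum_val k) (enum_val i).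
have : kermx M != 0.
  rewrite -mxrank_eq0 mxrank_ker subn_eq0 -ltnNge.
  exact: leq_ltn_trans (rank_leq_col _) lt.
case/rowV0Pn => u /sub_kermxP uM u0.
pose c b := \sum_(i < #|S|) u 0 i *+ (enum_val i == b).
have cE i : c (enum_val i) = u 0 i.
  rewrite /c (bigD1 i) //= eqxx mulr1n big1 ?addr0 // => j /negPf ji.
  by rewrite (inj_eq enum_val_inj) ji mulr0n.
exists c; split.
- have [i ui] : exists i, u 0 i != 0.
    by move/rV0Pn: u0 => [i ui]; exists i.
  by exists (enum_val i); rewrite cE.
- move=> b bS; rewrite /c big1 // => i _; case: eqP => [E|]; last by rewrite mulr0n.
  by case/negP: bS; rewrite -E enum_valP.
- move=> k; have := congr1 (fun v : 'rV_ _ => v 0 (enum_rank k)) uM.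
  rewrite !mxE => h; rewrite -[RHS]h.
  rewrite (bigID [in S]) /= [X in _ + X]big1 ?addr0; last first.
    move=> b bS; rewrite /c big1 ?mul0r // => i _; case: eqP => [E|]; last by rewrite mulr0n.
    by case/negP: bS; rewrite -E enum_valP.
  by rewrite big_enum_val; apply: eq_bigr => i _; rewrite cE mxE enum_rankK.
Qed.

Section KakeyaCount.
Variables (F : finFieldType) (n : nat) (x0 : 'rV[F]_n -> 'rV[F]_n).
Hypothesis n0 : (0 < n)%N.
Variable (m : 'rV[F]_n -> F -> nat).

Definition line_mass (al : 'rV[F]_n) : nat := \sum_t m (x0 al + t *: al) t.

(** The polynomial method, with multiplicities and with a set of monomials that
    depends on the degree. At each level [a], the forms of degree [n a] are built
    on monomials chosen so that no nonzero form has vanishing jets at the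
    directions of the lines of mass more than [2 n a]. If there were more
    monomials than vanishing conditions, some nonzero polynomial would vanish to
    order [m y s] at every point [(y, s)]. Its top form, say of degree [n a],
    would have zero jets at all those directions because of
    [hasse_top_form_eq0], which the choice of the monomials forbids.
    Treating all levels at once yields a sum over the lines of a power of their
    mass, hence a strong-type inequality. *)
Lemma kakeya_count (N : nat) :
  (\sum_(a < N) #|[set al | 2 * n * a < line_mass al]| * a.+1 ^ n <=
   (\sum_y \sum_s m y s ^ n.+1) * #|F| ^ n)%N.
Proof.
pose A (a : nat) := [set al | 2 * n * a < line_mass al]%N.
pose q := #|F|.
have q0 : (0 < q)%N by apply/card_gt0P; exists 0.
(* This is the least order for which polynomials of degree [a] in each variable
   are determined by their jets at all points of F^n. *)
pose J (a : nat) := (a %/ q).+1.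
have aJ a : (a < #|F| * J a)%N by rewrite mulnC ltn_ceil.
have [S cardS indepS] :=
  fin_all_exists2 (fun a : 'I_N => independent_monomials (aJ a) (A a)).
pose B : finType := {a : 'I_N & {ffun 'I_n -> 'I_a.+1}}.
(* The conditions at [(y, s)] are indexed by the box of side [m y s], which
   contains all multi-orders of total order less than [m y s]. *)
pose C : finType := {x : 'rV[F]_n * F & {ffun 'I_n.+1 -> 'I_(m x.1 x.2)}}.
pose SB : {set B} := [set b | tagged b \in S (tag b)].
have cardSB : #|SB| = (\sum_a #|S a|)%N.
  rewrite -sum1_card; under [RHS]eq_bigr => a _ do rewrite -sum1_card.
  by rewrite sig_big_dep /=; apply: eq_bigl => b; rewrite inE.
have cardC : #|C| = (\sum_y \sum_s m y s ^ n.+1)%N.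
  rewrite pair_big /= -sum1_card.
  under [RHS]eq_bigr => x _ do
    rewrite -[X in (_ ^ X)%N]card_ord -[X in (X ^ _)%N]card_ord -card_ffun -sum1_card.
  by rewrite sig_big_dep.
apply: (@leq_trans (\sum_a #|S a| * q ^ n)%N).
  by apply: leq_sum => a _; exact: cardS.
rewrite -big_distrl leq_mul2r -cardC -cardSB; apply/orP; right.
rewrite leqNgt; apply/negP => lt.
(* The last exponent makes the monomial homogeneous of degree [n * tag b]. *)
pose ex (b : B) : 'I_n.+1 -> nat :=
  snoc (fun l => tagged b l : nat) (n * tag b - \sum_l tagged b l)%N.
have degex b : (\sum_l ex b l = n * tag b)%N.
  rewrite sum_snoc subnKC // -[n in (n * _)%N]card_ord -sum_nat_const; apply: leq_sum => l _.
  by rewrite -ltnS ltn_ord.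
have [c [[b0 cb0] cS ck]] := exists_kernel
  (fun (k : C) b => hasse_mon (ex b) (fun l => tagged k l : nat)
                       (snoc ((tag k).1 0) (tag k).2)) lt.
have van y s (j : 'I_n.+1 -> nat) : (\sum_l j l < m y s)%N ->
    hasse_deriv ex c j (snoc (y 0) s) = 0.
  move=> jm.
  have jl l : (j l < m y s)%N by rewrite (leq_ltn_trans _ jm) // (bigD1 l) //= leq_addr.
  have := ck (Tagged (fun x : 'rV[F]_n * F => {ffun 'I_n.+1 -> 'I_(m x.1 x.2)})
                     (i := (y, s)) [ffun l => Ordinal (jl l)]).
  rewrite /hasse_deriv /= => h; rewrite -[RHS]h; apply: eq_bigr => b _; congr (_ * _).
  by apply: eq_bigr => l _; rewrite ffunE.
case: (@arg_maxnP B b0 (fun b => c b != 0) (fun b : B => tag b : nat) cb0) => b1 cb1 max1.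
pose a := tag b1; pose c' e := c (Tagged (fun a : 'I_N => {ffun 'I_n -> 'I_a.+1}) (i := a) e).
suff h : forall e, c' e = 0.
  have E : c b1 = c' (tagged b1) by rewrite /c' /a; case: (b1).
  by move: cb1; rewrite /= E h eqxx.
apply: indepS => [e eS|g gA].
  by apply: cS; rewrite inE.
pose al := jet_point g.
have h : \sum_(b | \sum_l ex b l == (n * a)%N)
    c b * hasse_mon (ex b) (snoc (fun l => (g l).2 : nat) 0%N) (snoc (al 0) 1) = 0.
  apply: (@hasse_top_form_eq0 F n.+1 B ex c (snoc (x0 al 0) 0) _
           (fun t => m (x0 al + t *: al) t)) => [t j jm|b cb|].
  - rewrite -[RHS](van _ _ _ jm); apply: eq_bigr => b _.
    congr (_ * _); apply: eq_bigr => l _; congr hasse_coef.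
    case: (unliftP ord_max l) => [l'|] ->; last by rewrite !snoc_max mulr1 add0r.
    rewrite (_ : lift ord_max l' = widen_ord (leqnSn n) l'); last exact/val_inj/lift_max.
    by rewrite !snoc_widen !mxE.
  - by rewrite degex leq_mul2l; apply/orP; right; exact: max1.
  rewrite sum_snoc addn0.
  have le1 : (\sum_l (g l).2 <= n * (a %/ q))%N.
    rewrite -[n in (n * _)%N]card_ord -sum_nat_const; apply: leq_sum => l _.
    by rewrite -ltnS ltn_ord.
  (* Differentiating [|i| <= n (a / q)] times costs at most [q |i| <= n a] along
     the line, whose mass exceeds [2 n a]; more than [n a] zeros are left. *)
  have le2 : (line_mass al <= \sum_t (m (x0 al + t *: al) t - \sum_l (g l).2)
                 + q * (n * (a %/ q)))%N.
    rewrite -sum_nat_const -big_split; apply: leq_sum => t _ /=.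
    by apply: leq_trans (leq_add (leqnn _) le1); rewrite addnC -maxnE leq_maxr.
  have le3 := leq_divM a q.
  move: gA; rewrite inE => gA.
  have le4 : (q * (n * (a %/ q)) <= n * a)%N by rewrite mulnCA leq_mul2l mulnC le3 orbT.
  move: le2 le4 gA; rewrite -(mulnA 2) -/al.
  move: (line_mass _) (\sum_t (_ - _))%N (q * _)%N (n * a)%N => M X Y Z; lia.
rewrite -[RHS]h.
under [RHS]eq_bigl => b do rewrite degex eqn_pmul2l // (inj_eq val_inj).
transitivity (\sum_(a' | a' == a) \sum_(e : {ffun 'I_n -> 'I_a'.+1})
   c (Tagged (fun a : 'I_N => {ffun 'I_n -> 'I_a.+1}) (i := a') e) *
   hasse_mon (ex (Tagged (fun a : 'I_N => {ffun 'I_n -> 'I_a.+1}) (i := a') e))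
     (snoc (fun l => (g l).2 : nat) 0%N) (snoc (al 0) 1)).
  rewrite big_pred1_eq; apply: eq_bigr => e _; congr (_ * _).
  rewrite /hasse_mon big_ord_recr /= /ex !snoc_max {2}/hasse_coef expr1n bin0 mulr1.
  by apply: eq_bigr => l _; rewrite !snoc_widen mxE.
rewrite sig_big_dep /=; apply: eq_big => [b|b _]; first by rewrite andbT.
by case: b.
Qed.

End KakeyaCount.

(** * The Kakeya maximal inequality *)

Lemma expnS_le (n L : nat) : (L.+1 ^ n.+1 <= L ^ n.+1 + n.+1 * L.+1 ^ n)%N.
Proof.
elim: n => [|n IHn]; first by rewrite !expn1 expn0; lia.
have h : (L * L.+1 ^ n <= L.+1 ^ n.+1)%N by rewrite expnS leq_mul2r leqnSn orbT.
rewrite expnS [(L ^ n.+2)%N]expnS.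
by move: IHn h; move: (L.+1 ^ n.+1)%N (L.+1 ^ n)%N (L ^ n.+1)%N => X Y Z; nia.
Qed.

Lemma exp_le_sum_exp (n L : nat) : (L ^ n.+1 <= n.+1 * \sum_(a < L) a.+1 ^ n)%N.
Proof.
elim: L => [|L IHL]; first by rewrite exp0n.
rewrite big_ord_recr mulnDr /=.
by apply: leq_trans (expnS_le n L) _; rewrite leq_add2r.
Qed.

Lemma exp_le_sum_lt (n k T N : nat) : (0 < k)%N -> (T <= N)%N ->
  (T ^ n.+1 <= k ^ n.+1 * n.+1 * \sum_(a < N | k * a < T) a.+1 ^ n)%N.
Proof.
move=> k0 TN; (* [L] is the ceiling of [T / k], so that [k * a < T] exactly when [a < L]. *)
pose L := ((T + k.-1) %/ k)%N.
have Lk : (L * k <= T + k.-1)%N := leq_divM _ _.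
have kL : (T + k.-1 < L.+1 * k)%N := ltn_ceil _ k0.
have TL : (T <= k * L)%N by move: kL; rewrite mulSn mulnC; lia.
have LN : (L <= N)%N by rewrite leqNgt; apply/negP => NL; move: Lk TN; nia.
apply: (@leq_trans ((k * L) ^ n.+1)%N); first by rewrite leq_exp2r.
rewrite expnMn -mulnA leq_mul2l; apply/orP; right.
apply: leq_trans (exp_le_sum_exp n L) _; rewrite leq_mul2l; apply/orP; right.
rewrite (big_ord_widen _ (fun a => a.+1 ^ n)%N LN) [leqRHS]big_mkcond [leqLHS]big_mkcond.
apply: leq_sum => a _; case: ltnP => // aL; case: ifP => // /negbT.
by rewrite -leqNgt => Tk; exfalso; move: Lk; nia.
Qed.

Section Kakeya.
Variables (F : finFieldType) (n : nat) (x0 : 'rV[F]_n -> 'rV[F]_n).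
Hypothesis n0 : (0 < n)%N.

Definition kakeya_const := ((2 * n) ^ n.+1 * n.+1)%N.

(** Summing [kakeya_count] over the levels: a line of mass [T] counts at the
    levels [a < T / (2 n)], where the weights [a.+1 ^ n] add up to at least a
    constant multiple of [T ^ n.+1]. *)
Lemma kakeya_nat (m : 'rV[F]_n -> F -> nat) :
  (\sum_al (\sum_t m (x0 al + t *: al)%R t) ^ n.+1 <=
   kakeya_const * ((\sum_y \sum_s m y s ^ n.+1) * #|F| ^ n))%N.
Proof.
pose T al := line_mass x0 m al; pose N := (\max_al T al)%N.
apply: leq_trans (leq_mul (leqnn _) (kakeya_count x0 n0 m N)).
under [X in (_ <= _ * X)%N]eq_bigr => a _ do rewrite -sum1_card big_distrl /= big_mkcond.
rewrite exchange_big big_distrr /=; apply: leq_sum => al _.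
apply: (leq_trans (exp_le_sum_lt (k := 2 * n) n _ (leq_bigmax (F := T) al))); first by rewrite muln_gt0.
rewrite leq_mul2l big_mkcond; apply/orP; right; apply: leq_sum => a _.
by rewrite inE mul1n.
Qed.

(** The Kakeya maximal inequality from L^d to L^d with d = n + 1: as [x0] is
    arbitrary, the line in each direction may be one on which the sum of [f] is
    largest. Both sides have the same homogeneity, so that integer weights suffice:
    after a large dilation, rounding up at most doubles the nonzero values
    of [f]. *)
Lemma kakeya_maximal (R : realType) (f : 'rV[F]_n -> F -> R) : (forall y s, 0 <= f y s) ->
  \sum_al (\sum_t f (x0 al + t *: al) t) ^+ n.+1 <=
   (2 ^ n.+1 * kakeya_const)%N%:R * #|F|%:R ^+ n * \sum_y \sum_s f y s ^+ n.+1.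
Proof.
move=> f0.
(* With the convention [0^-1 = 0], [M] is at least the inverse of each nonzero
   value of [f]. *)
pose M := 1 + \sum_y \sum_s (f y s)^-1.
have M0 : 0 < M.
  by rewrite ltr_wpDr // sumr_ge0 // => y _; rewrite sumr_ge0 // => s _; rewrite invr_ge0.
have Mf y s : f y s != 0 -> 1 <= M * f y s.
  move=> fn; have fp : 0 < f y s by rewrite lt_def fn f0.
  rewrite -ler_pdivrMr // mul1r /M (bigD1 y) //= (bigD1 s) //= addrCA -addrA lerDl.
  by rewrite !addr_ge0 // sumr_ge0 // => *; rewrite ?invr_ge0 // sumr_ge0 // => *; rewrite invr_ge0.
pose m y s := if f y s == 0 then 0%N else (Num.truncn (M * f y s)).+1.
have mlo y s : M * f y s <= (m y s)%:R.
  rewrite /m; case: eqP => [->|_]; first by rewrite mulr0.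
  by apply: ltW; apply: truncnS_gt; rewrite mulr_ge0 // ltW.
have mhi y s : (m y s)%:R <= 2 * (M * f y s).
  rewrite /m; case: eqVneq => [->|fn]; first by rewrite !mulr0.
  rewrite -addn1 natrD mulr_natl mulr2n lerD ?Mf //.
  by rewrite truncn_le // mulr_ge0 // ltW.
have := kakeya_nat m; rewrite -(ler_nat R); move: kakeya_const => K H.
rewrite -(ler_pM2l (exprn_gt0 n.+1 M0)).
apply: le_trans (le_trans _ H) _.
  rewrite natr_sum mulr_sumr; apply: ler_sum => al _; rewrite natrX natr_sum -exprMn mulr_sumr.
  apply: lerXn2r; rewrite ?nnegrE ?sumr_ge0 // ; try by move=> t _; rewrite mulr_ge0 // ltW.
  exact: ler_sum.
have S : (\sum_y \sum_s m y s ^ n.+1)%N%:R <= 2 ^+ n.+1 * M ^+ n.+1 * \sum_y \sum_s f y s ^+ n.+1.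
  rewrite natr_sum mulr_sumr; apply: ler_sum => y _.
  rewrite natr_sum mulr_sumr; apply: ler_sum => s _.
  by rewrite natrX -!exprMn -mulrA lerXn2r ?nnegrE ?mulr_ge0 // ?ltW.
rewrite !natrM !natrX.
apply: le_trans (ler_wpM2l (ler0n _ _) (ler_wpM2r _ S)) _; first by rewrite exprn_ge0.
by rewrite le_eqVlt; apply/orP; left; apply/eqP; ring.
Qed.

End Kakeya.

(** * The canonical additive character *)

Section Character.
Variables (R : realType) (F : finFieldType).
Local Notation p := (fchar F).
Local Notation chi := (@add_char R F).

Let p_prime : prime p. Proof. exact: pcharf_prime (fcharP F). Qed.

Lemma abs_traceE (c : F) : (abs_trace_Fp c : nat)%:R = abs_trace c.
Proof.
rewrite /abs_trace_Fp; case: pickP => [k /eqP //|none].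
pose L := pPrimeCharType (fcharP F).
have : galTrace 1%AS {: L}%AS (c : L) \in (1%AS : {subfield L}).
  by apply: mem_galTrace (memvf _); apply: finField_galois; exact: sub1v.
case/vlineP => k kE; have := none k; rewrite /abs_trace kE /=.
have -> : k *: (1 : pPrimeCharType (fcharP F)) = k%:R * (1 : F) by [].
by rewrite mulr1 eqxx.
Qed.

(** The representatives in ['F_p] are less than p, so they stay distinct in [F]. *)
Lemma natr_Fp_inj (j k : 'F_p) : (j : nat)%:R = (k : nat)%:R :> F -> j = k.
Proof.
have h (x y : 'F_p) : (x <= y)%N -> (x : nat)%:R = (y : nat)%:R :> F -> x = y.
  move=> xy e; apply/val_inj/eqP; rewrite eqn_leq xy leqNgt; apply/negP => lt.
  have : (p %| y - x)%N by rewrite (dvdn_pcharf (fcharP F)) natrB // e subrr.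
  move/dvdn_leq; rewrite subn_gt0 => /(_ lt); rewrite leqNgt => /negP; apply.
  rewrite (leq_ltn_trans (leq_subr _ _)) // -[ltnRHS](Fp_cast p_prime).
  exact: ltn_ord.
by case/orP: (leq_total j k) => l e; [apply: h|apply/esym/h].
Qed.

Lemma abs_traceD (a b : F) : abs_trace (a + b) = abs_trace a + abs_trace b.
Proof. exact: (raddfD (galTrace 1%AS {: pPrimeCharType (fcharP F)}%AS)). Qed.

(** Linear independence of the automorphisms of [F]. *)
Lemma abs_trace_neq0 : exists c : F, abs_trace c != 0.
Proof.
have [|a _] := @gal_independent_contra _ _ {: pPrimeCharType (fcharP F)}%AS
  [in ('Gal({: pPrimeCharType (fcharP F)}%AS / 1%AS))%g] (fun=> 1) _ (fingroup.group1 _).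
  exact: oner_neq0.
by under eq_bigr do rewrite mul1r; exists a.
Qed.

Definition cis (x : R) : R[i] := Complex (cos x) (sin x).

Lemma cisD x y : cis (x + y) = cis x * cis y.
Proof. by rewrite /cis cosD sinD; apply/eqP; rewrite eq_complex /= eqxx addrC eqxx. Qed.

Definition char_angle (m : nat) : R := 2 * pi * m%:R / p%:R.

Lemma cis_char_angle_modn (m : nat) : cis (char_angle (m %% p)) = cis (char_angle m).
Proof.
have p0 : (p%:R : R) != 0 by rewrite pnatr_eq0 -lt0n prime_gt0.
have H k j : cis (char_angle (k * p + j)) = cis (char_angle j).
  elim: k => [|k <-]; first by rewrite mul0n.
  have -> : char_angle (k.+1 * p + j) = char_angle (k * p + j) + pi *+ 2.
    by rewrite /char_angle mulSn -addnA natrD -mulr_natr; field.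
  by rewrite /cis cosD2pi sinD2pi.
by rewrite [in RHS](divn_eq m p) H.
Qed.

Lemma add_charD (a b : F) : chi (a + b) = chi a * chi b.
Proof.
rewrite /add_char -!/(char_angle _) -!/(cis _) -cisD.
have -> : char_angle (abs_trace_Fp a) + char_angle (abs_trace_Fp b) =
          char_angle (abs_trace_Fp a + abs_trace_Fp b)%N.
  by rewrite /char_angle natrD; ring.
rewrite -[RHS]cis_char_angle_modn; congr (cis (char_angle _)).
suff : abs_trace_Fp (a + b) = abs_trace_Fp a + abs_trace_Fp b.
  by move=> -> /=; congr (_ %% _)%N; exact: Fp_cast.
apply: natr_Fp_inj; rewrite abs_traceE abs_traceD -!abs_traceE -natrD /=.
set m := (abs_trace_Fp a + abs_trace_Fp b)%N.
have -> : (m %% (Zp_trunc (pdiv p)).+2 = m %% p)%N by congr (_ %% _)%N; exact: Fp_cast.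
by rewrite [in LHS](divn_eq m p) natrD natrM (pcharf0 (fcharP F)) mulr0 add0r.
Qed.

Lemma normc_char (c : F) : Normc.normc (chi c) = 1.
Proof. by rewrite /= cos2Dsin2 sqrtr1. Qed.

(** At an element of nonzero trace the angle is [2 x] with [0 < x < pi], and
    [cos (2 x) = 1 - 2 sin^2 x < 1]. *)
Lemma add_char_nontrivial : exists c : F, chi c != 1.
Proof.
have [c tc] := abs_trace_neq0; exists c; apply/negP => /eqP/(congr1 (@complex.Re R)) /=.
set k := (abs_trace_Fp c : nat) => cos1.
have k0 : (0 < k)%N.
  by rewrite lt0n; apply: contraNneq tc => k0; rewrite -abs_traceE -/k k0.
have kp : (k < p)%N by rewrite -[ltnRHS](Fp_cast p_prime) ltn_ord.
have p0 : 0 < (p%:R : R) by rewrite ltr0n prime_gt0.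
pose x : R := pi * (k%:R / p%:R).
have xx : 2 * pi * k%:R / p%:R = x + x by rewrite /x; ring.
have sx : 0 < sin x.
  apply: sin_gt0_pi; apply/andP; split.
    by rewrite mulr_gt0 ?pi_gt0 // divr_gt0 // ltr0n.
  by rewrite -[ltRHS]mulr1 ltr_pM2l ?pi_gt0 // ltr_pdivrMr // mul1r ltr_nat.
have := cos2Dsin2 x; have : sin x ^+ 2 > 0 by rewrite exprn_gt0.
move: cos1; rewrite xx cosD -!expr2 => e1 lt e2.
have : sin x ^+ 2 + sin x ^+ 2 = 0.
  have -> : sin x ^+ 2 + sin x ^+ 2 = (cos x ^+ 2 + sin x ^+ 2) - (cos x ^+ 2 - sin x ^+ 2) by ring.
  by rewrite e2 e1 subrr.
by move/eqP; rewrite (gt_eqF (addr_gt0 lt lt)).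
Qed.

Lemma add_char0 : chi 0 = 1.
Proof.
have : chi 0 != 0.
  by apply/eqP => h; have := normc_char 0; rewrite h Normc.normc0 => /eqP; rewrite eq_sym oner_eq0.
by move=> h; apply: (mulfI h); rewrite -add_charD addr0 mulr1.
Qed.

Lemma add_char_conj (c : F) : (chi c)^*%C = chi (- c).
Proof.
have h : chi c != 0.
  by apply/eqP => h; have := normc_char c; rewrite h Normc.normc0 => /eqP; rewrite eq_sym oner_eq0.
apply: (mulfI h); rewrite -add_charD subrr add_char0.
by rewrite -sqr_normc normc_def; have := normc_char c => /= ->; rewrite expr1n.
Qed.

(** For [y != 0], translating the sum by a vector [z] with [chi (z . y) != 1]
    multiplies it by that number and does not change it. *)
Lemma sum_char_dotv n (y : 'rV[F]_n) :
  \sum_x chi (dotv x y) = if y == 0 then #|F|%:R ^+ n else 0.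
Proof.
case: eqP => [->|/eqP/rV0Pn[i yi]].
  rewrite (eq_bigr (fun=> 1)) => [|x _].
    by rewrite sumr_const card_mx mul1n natrX.
  by rewrite /dotv big1 ?add_char0 // => j _; rewrite mxE mulr0.
have [c cn] := add_char_nontrivial.
pose z : 'rV[F]_n := (c / y 0 i) *: delta_mx 0 i.
have zy : dotv z y = c.
  rewrite /dotv (bigD1 i) //= !mxE !eqxx mulr1 divfK // big1 ?addr0 // => j /negPf ji.
  by rewrite !mxE eqxx /= ji mulr0 mul0r.
set S := \sum_x _.
have SE : S = chi c * S.
  rewrite mulr_sumr {1}/S (reindex (fun x => z + x)) /=; last first.
    by exists (fun x => x - z) => x _; rewrite ?addKr // addrC ?subrK ?addrK // addKr.
  apply: eq_bigr => x _; rewrite -add_charD -zy /dotv -big_split /=; congr chi.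
  by apply: eq_bigr => j _; rewrite mxE mulrDl.
have : (1 - chi c) * S = 0 by rewrite mulrBl mul1r -SE subrr.
by move/eqP; rewrite mulf_eq0 subr_eq0 eq_sym (negPf cn) /= => /eqP.
Qed.

End Character.

(** * Convexity of powers *)

Section Jensen.
Variable R : realType.
Implicit Types (s : R).

(** The graph of [x |-> x ^ s] lies above its tangent at [m]. This is Young's
    inequality for [x] and [m ^ (s - 1)]. *)
Lemma powR_tangent s (m x : R) : 1 <= s -> 0 < m -> 0 <= x ->
  m `^ s + s * m `^ (s - 1) * (x - m) <= x `^ s.
Proof.
move=> s1 m0 x0; have s0 : 0 < s by apply: lt_le_trans s1.
have [<-|ns1] := eqVneq 1 s.
  by rewrite subrr powRr0 !powRr1 ?(ltW m0) // !mul1r addrCA subrr addr0.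
have s1' : 0 < s - 1 by rewrite subr_gt0 lt_neqAle ns1.
have := @conjugate_powR R x (m `^ (s - 1)) s (s / (s - 1)) x0 (powR_ge0 _ _) s0 (divr_gt0 s0 s1').
have ns : s != 0 by rewrite gt_eqF.
have ns' : s - 1 != 0 by rewrite gt_eqF.
rewrite -powRrM (_ : (s - 1) * (s / (s - 1)) = s); last by field.
have -> : s^-1 + (s / (s - 1))^-1 = 1 by field; rewrite ns ns'.
move=> /(_ erefl) H.
have E : m `^ (s - 1) * m = m `^ s by rewrite mulrC mulr_powRB1 // ltW.
have := ler_wpM2l (ltW s0) H.
have -> : s * (x `^ s / s + m `^ s / (s / (s - 1))) = x `^ s + (s - 1) * m `^ s.
  by field; rewrite ns ns'.
rewrite mulrBr -[s * _ * m]mulrA E => H2; lra.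
Qed.

(** Jensen's inequality with the weights [b], multiplied out so that it also holds
    when their sum is zero: apply [powR_tangent] at the weighted mean. *)
Lemma jensen_powR (I : finType) (a b : I -> R) s : 1 <= s ->
  (forall i, 0 <= a i) -> (forall i, 0 <= b i) ->
  (\sum_i a i * b i) `^ s <= (\sum_i a i `^ s * b i) * (\sum_i b i) `^ (s - 1).
Proof.
move=> s1 a0 b0; have s0 : 0 < s by apply: lt_le_trans s1.
have ns : s != 0 by rewrite gt_eqF.
have rhs0 : 0 <= (\sum_i a i `^ s * b i) * (\sum_i b i) `^ (s - 1).
  by rewrite mulr_ge0 ?powR_ge0 // sumr_ge0 // => i _; rewrite mulr_ge0 ?powR_ge0.
have [B0|Bn0] := eqVneq (\sum_i b i) 0.
  have bz i : b i = 0.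
    by have /psumr_eq0P := B0; apply.
  by rewrite [X in X `^ _ <= _]big1 ?powR0 // => i _; rewrite bz mulr0.
have Bp : 0 < \sum_i b i by rewrite lt_def Bn0 sumr_ge0.
set B := \sum_i b i in Bp Bn0 rhs0 *.
pose A := \sum_i a i * b i.
have [A0|An0] := eqVneq A 0; first by rewrite -/A A0 powR0.
have Ap : 0 < A by rewrite lt_def An0 sumr_ge0 // => i _; rewrite mulr_ge0.
pose m := A / B; have m0 : 0 < m by rewrite divr_gt0.
have key : m `^ s * B <= \sum_i a i `^ s * b i.
  apply: (@le_trans _ _ (\sum_i (m `^ s + s * m `^ (s - 1) * (a i - m)) * b i)); last first.
    by apply: ler_sum => i _; rewrite ler_wpM2r // powR_tangent.
  rewrite (eq_bigr (fun i => m `^ s * b i + s * m `^ (s - 1) * (a i * b i - m * b i))); last first.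
    by move=> i _; ring.
  rewrite big_split /= -!mulr_sumr sumrB -mulr_sumr -/A -/B.
  by rewrite (_ : A - m * B = 0) ?mulr0 ?addr0 // /m divfK // subrr.
rewrite -/A (_ : A = m * B); last by rewrite /m divfK.
rewrite powRM ?(ltW m0) ?(ltW Bp) // -[B `^ s]mulr_powRB1 ?(ltW Bp) // mulrA.
by rewrite ler_wpM2r // powR_ge0.
Qed.

End Jensen.

(** * The adjoint X-ray estimate *)

(** Jensen's inequality with weights [c * y ^ p'] and values [x * y ^ (1 - p')],
    where [p'] is the exponent conjugate to [p]. *)
Lemma hoelder_powR (R : realType) (I : finType) (x y : I -> R) (c p : R) :
  0 <= c -> 1 < p -> (forall i, 0 <= x i) -> (forall i, 0 <= y i) ->
  (\sum_i c * (x i * y i)) `^ p <=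
  (\sum_i c * x i `^ p) * (\sum_i c * y i `^ (p / (p - 1))) `^ (p - 1).
Proof.
move=> c0 p1 x0 y0; have p1' : 0 < p - 1 by rewrite subr_gt0.
have p0 : 0 < p by apply: lt_trans p1.
have np : p - 1 != 0 by rewrite gt_eqF.
set p' := p / (p - 1); have p'0 : 0 < p' by rewrite divr_gt0.
have p'1 : 1 - p' != 0.
  by rewrite (_ : 1 - p' = - (p - 1)^-1) ?oppr_eq0 ?invr_eq0 // /p'; field.
have h := @jensen_powR R I (fun i => x i * y i `^ (1 - p')) (fun i => c * y i `^ p') p (ltW p1)
  (fun i => mulr_ge0 (x0 i) (powR_ge0 _ _)) (fun i => mulr_ge0 c0 (powR_ge0 _ _)).
apply: (@le_trans _ _ ((\sum_i x i * y i `^ (1 - p') * (c * y i `^ p')) `^ p)).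
  rewrite le_eqVlt; apply/orP; left; apply/eqP; congr (_ `^ _); apply: eq_bigr => i _.
  have [->|yn] := eqVneq (y i) 0.
    by rewrite [0 `^ p']powR0 ?gt_eqF // !mulr0.
  have -> : x i * y i `^ (1 - p') * (c * y i `^ p') = c * (x i * (y i `^ (1 - p') * y i `^ p')) by ring.
  by rewrite -powRD ?yn ?implybT // subrK powRr1.
apply: (le_trans h).
rewrite ler_wpM2r ?powR_ge0 //; apply: ler_sum => i _.
rewrite powRM ?powR_ge0 // -powRrM mulrCA -mulrA ler_wpM2l //.
rewrite -[leRHS]mulr1 ler_wpM2l ?powR_ge0 //.
have [->|yn] := eqVneq (y i) 0.
  by rewrite [X in _ * X]powR0 ?mulr0 ?gt_eqF.
rewrite -powRD ?yn ?implybT // (_ : _ + _ = 0) ?powRr0 // /p'; field; exact: np.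
Qed.

Section Dual.
Variables (R : realType) (F : finFieldType) (n : nat).
Hypothesis n0 : (0 < n)%N.
Local Notation q := (#|F|%:R : R).
Local Notation dK := ((2 ^ n.+1 * kakeya_const n)%N%:R : R).

Lemma kakeya_opp (x0 : 'rV[F]_n -> 'rV[F]_n) (f : 'rV[F]_n -> F -> R) :
  (forall y s, 0 <= f y s) ->
  \sum_al (\sum_t f (x0 al - t *: al) t) ^+ n.+1 <=
   dK * q ^+ n * \sum_y \sum_s f y s ^+ n.+1.
Proof.
move=> f0; apply: le_trans (kakeya_maximal (fun al => x0 (- al)) n0 f0).
rewrite (reindex_inj oppr_inj) /= le_eqVlt; apply/orP; left; apply/eqP.
by apply: eq_bigr => al _; congr (_ ^+ _); apply: eq_bigr => t _; rewrite scalerN opprK.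
Qed.

Variables (G : 'rV[F]_n -> 'rV[F]_n -> R) (u : R).
Hypothesis G0 : forall al ga, 0 <= G al ga.
Hypothesis un : n.+1%:R / n%:R <= u.

(** The adjoint of the X-ray transform: [G al ga] is a weight on the line of the
    points [(ga - t *: al, t)], and the weights of the lines through [(y, t)] are
    averaged. *)
Definition xray_adj (y : 'rV[F]_n) (t : F) : R := (q ^+ n)^-1 * \sum_al G al (y + t *: al).
Local Notation H := xray_adj.

Let v := u * n%:R / (u * n%:R - 1).
Let nR : (0 : R) < n%:R. Proof. by rewrite ltr0n. Qed.
Let u1 : 1 < u.
Proof. by apply: lt_le_trans un; rewrite ltr_pdivlMr // mul1r ltr_nat. Qed.
Let u0 : 0 < u. Proof. exact: lt_trans u1. Qed.
Let un1 : n.+1%:R <= u * n%:R. Proof. by rewrite -ler_pdivrMr. Qed.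
Let un1' : 0 < u * n%:R - 1.
Proof. by rewrite subr_gt0; apply: lt_le_trans un1; rewrite ltr1n. Qed.
Let q0 : 0 < q. Proof. by rewrite ltr0n; apply/card_gt0P; exists 0. Qed.

Lemma xray_adj_ge0 y t : 0 <= H y t.
Proof. by rewrite mulr_ge0 ?invr_ge0 ?exprn_ge0 // sumr_ge0. Qed.

Let S := \sum_y \sum_t H y t `^ u.

Let S0 : 0 <= S.
Proof. by rewrite sumr_ge0 // => y _; rewrite sumr_ge0 // => t _; rewrite powR_ge0. Qed.

(** Interpolation on one line between the trivial bound by the total sum and the
    sum of [H ^ (u / d)], whose d-th power [kakeya_maximal] controls. With
    [s = u n / d >= 1], this is Jensen's inequality with exponent [s], weights
    [H ^ u] and values [H^-1], the points where [H] vanishes contributing nothing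
    since [0^-1 = 0]. *)
Lemma xray_adj_line_le (x : 'rV[F]_n) al :
  (\sum_t H (x - t *: al) t `^ (u - 1)) `^ (u * n%:R) <=
  (\sum_t H (x - t *: al) t `^ (u / n.+1%:R)) ^+ n.+1 * S `^ (u * n%:R - n.+1%:R).
Proof.
pose s := u * n%:R / n.+1%:R.
have nR1 : (0 : R) < n.+1%:R by rewrite ltr0n.
have nR1' : n.+1%:R != 0 :> R by rewrite gt_eqF.
have s1 : 1 <= s by rewrite ler_pdivlMr // mul1r.
have s0 : 0 < s by apply: lt_le_trans s1.
pose h t := H (x - t *: al) t.
have h0 t : 0 <= h t by exact: xray_adj_ge0.
have us : u - s = u / n.+1%:R by rewrite /s -natr1; field; rewrite natr1.
have hV0 t : 0 <= (h t)^-1 by rewrite invr_ge0.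
have J := @jensen_powR R F (fun t => (h t)^-1) (fun t => h t `^ u) s s1 hV0
  (fun t => powR_ge0 _ _).
have E1 : \sum_t (h t)^-1 * h t `^ u = \sum_t h t `^ (u - 1).
  apply: eq_bigr => t _; have [->|hn] := eqVneq (h t) 0.
    by rewrite invr0 mul0r powR0 // subr_eq0 gt_eqF.
  by rewrite powRB ?hn ?implybT // powRr1 // mulrC.
have E2 : \sum_t (h t)^-1 `^ s * h t `^ u = \sum_t h t `^ (u / n.+1%:R).
  apply: eq_bigr => t _; have [->|hn] := eqVneq (h t) 0.
    by rewrite !powR0 ?mulr0 // ?gt_eqF // divr_gt0.
  rewrite -us powRB ?hn ?implybT // mulrC; congr (_ * _).
  by rewrite -powR_inv1 // -powRrM mulN1r powRN.
rewrite E1 E2 in J.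
have hS : \sum_t h t `^ u <= S.
  rewrite /S exchange_big /=; apply: ler_sum => t _.
  by rewrite (bigD1 (x - t *: al)) //= lerDl sumr_ge0 // => y _; rewrite powR_ge0.
have J2 : (\sum_t h t `^ (u - 1)) `^ s <= (\sum_t h t `^ (u / n.+1%:R)) * S `^ (s - 1).
  apply: (le_trans J); apply: ler_wpM2l; first by rewrite sumr_ge0 // => t _; rewrite powR_ge0.
  rewrite ge0_ler_powR ?nnegrE ?subr_ge0 //.
  by rewrite sumr_ge0 // => t _; rewrite powR_ge0.
have -> : u * n%:R = s * n.+1%:R by rewrite /s divfK.
rewrite powRrM powR_mulrn ?powR_ge0 //.
have -> : s * n.+1%:R - n.+1%:R = (s - 1) * n.+1%:R by ring.
rewrite [S `^ _]powRrM powR_mulrn ?powR_ge0 // -exprMn lerXn2r ?nnegrE ?powR_ge0 //.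
by rewrite mulr_ge0 ?powR_ge0 // sumr_ge0 // => t _; rewrite powR_ge0.
Qed.

(** Duality with the Kakeya maximal function. Pairing [H] with [H ^ (u - 1)] and
    unfolding [H] turns the sum [S] of [H ^ u] into an average over the
    directions of [sum_ga G al ga] times a sum of [H ^ (u - 1)] on a line.
    Hoelder's inequality with exponent [v], whose conjugate is [u n], together
    with [xray_adj_line_le] and [kakeya_maximal] bounds [S ^ v] by a multiple of
    [S ^ (v - v / u)], and dividing by this power gives the claim. *)
Lemma sum_xray_adj_le :
  S `^ (v / u) <= dK `^ (v - 1) * ((q ^+ n)^-1 * \sum_al (\sum_ga G al ga) `^ v).
Proof.
have qn0 : 0 < q ^+ n by rewrite exprn_gt0.
have v1 : 1 < v by rewrite /v ltr_pdivlMr // mul1r ltrBlDr ltrDl.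
have v0 : 0 < v by apply: lt_trans v1.
have [Sz|Sn] := eqVneq S 0.
  rewrite Sz powR0; last by rewrite gt_eqF // divr_gt0.
  apply: mulr_ge0; first exact: powR_ge0.
  rewrite mulr_ge0 ?invr_ge0 ?(ltW qn0) // sumr_ge0 // => al _; exact: powR_ge0.
have Sp : 0 < S by rewrite lt_def Sn.
pose L al x := \sum_t H (x - t *: al) t `^ (u - 1).
have L0 al x : 0 <= L al x by rewrite sumr_ge0 // => t _; rewrite powR_ge0.
pose x0 al := [arg max_(x > (0 : 'rV[F]_n)) L al x]%O.
have Lmax al x : L al x <= L al (x0 al).
  rewrite /x0.
  by case: (@Order.TotalTheory.arg_maxP _ _ _ (0 : 'rV[F]_n) xpredT (L al) isT) => i _; apply.
pose g al := \sum_ga G al ga.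
have g0 al : 0 <= g al by rewrite sumr_ge0.
have SE : S = \sum_al (q ^+ n)^-1 * (\sum_ga G al ga * L al ga).
  transitivity (\sum_al \sum_t \sum_y
     (q ^+ n)^-1 * (G al (y + t *: al) * H y t `^ (u - 1))).
    rewrite /S [LHS]exchange_big [RHS]exchange_big; apply: eq_bigr => t _ /=.
    rewrite [RHS]exchange_big; apply: eq_bigr => y _ /=.
    rewrite -mulr_powRB1 ?xray_adj_ge0 // {1}/xray_adj -mulrA mulr_suml mulr_sumr.
    by [].
  apply: eq_bigr => al _; rewrite mulr_sumr.
  under [RHS]eq_bigr => ga _ do rewrite /L mulr_sumr mulr_sumr.
  rewrite [RHS]exchange_big; apply: eq_bigr => t _ /=.
  rewrite [RHS](reindex_inj (addIr (t *: al))) /=.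
  by apply: eq_bigr => y _; rewrite addrK.
have SleM : S <= \sum_al (q ^+ n)^-1 * (g al * L al (x0 al)).
  rewrite {1}SE; apply: ler_sum => al _; rewrite ler_wpM2l ?invr_ge0 ?(ltW qn0) //.
  by rewrite mulr_suml; apply: ler_sum => ga _; rewrite ler_wpM2l.
have Mle : \sum_al (q ^+ n)^-1 * L al (x0 al) `^ (u * n%:R) <= dK * S `^ (u * n%:R - n%:R).
  apply: (@le_trans _ _ (\sum_al (q ^+ n)^-1 *
     ((\sum_t H (x0 al - t *: al) t `^ (u / n.+1%:R)) ^+ n.+1 * S `^ (u * n%:R - n.+1%:R)))).
    by apply: ler_sum => al _; rewrite ler_wpM2l ?invr_ge0 ?(ltW qn0) // xray_adj_line_le.
  rewrite -mulr_sumr -mulr_suml.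
  have := kakeya_opp x0 (f := fun y t => H y t `^ (u / n.+1%:R)) (fun y t => powR_ge0 _ _).
  have -> : \sum_y \sum_t (H y t `^ (u / n.+1%:R)) ^+ n.+1 = S.
    apply: eq_bigr => y _; apply: eq_bigr => t _.
    by rewrite -powR_mulrn ?powR_ge0 // -powRrM divfK // pnatr_eq0.
  move=> K.
  have -> : u * n%:R - n%:R = 1 + (u * n%:R - n.+1%:R) by rewrite -natr1; ring.
  rewrite [S `^ (1 + _)]powRD ?Sn ?implybT // powRr1 // !mulrA ler_wpM2r ?powR_ge0 //.
  by rewrite mulrC ler_pdivrMr // (le_trans K) // mulrAC.
have ne1 : u * n%:R - 1 != 0 by rewrite gt_eqF.
have ne0 : u != 0 by rewrite gt_eqF.
have vm : v - 1 = (u * n%:R - 1)^-1 by rewrite /v; field.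
have vE : v / (v - 1) = u * n%:R by rewrite vm invrK /v divfK.
have c0 : 0 <= (q ^+ n)^-1 by rewrite invr_ge0 ltW.
have Ho := hoelder_powR c0 v1 g0 (fun al => L0 al (x0 al)).
have gS : 0 <= \sum_al (q ^+ n)^-1 * g al `^ v.
  by rewrite sumr_ge0 // => al _; rewrite mulr_ge0 ?powR_ge0.
have dK0 : 0 <= dK by [].
have H1 : S `^ v <= (\sum_al (q ^+ n)^-1 * g al `^ v) * (dK * S `^ (u * n%:R - n%:R)) `^ (v - 1).
  apply: le_trans (le_trans Ho _).
    by rewrite ge0_ler_powR ?nnegrE ?(ltW v0) // (le_trans S0).
  rewrite ler_wpM2l // vE ge0_ler_powR ?nnegrE ?subr_ge0 ?(ltW v1) //.
    by rewrite sumr_ge0 // => al _; rewrite mulr_ge0 ?powR_ge0.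
  by rewrite mulr_ge0 ?powR_ge0.
have eE : (u * n%:R - n%:R) * (v - 1) = v - v / u.
  by rewrite vm /v; field; rewrite ne0 ne1.
have Se : 0 < S `^ (v - v / u) by rewrite powR_gt0.
rewrite -(ler_pM2r Se) -powRD ?Sn ?implybT // addrC subrK; apply: (le_trans H1).
by rewrite powRM ?powR_ge0 // -powRrM eE -mulr_sumr mulrA [_ * dK `^ _]mulrC.
Qed.

End Dual.

(** * Plancherel's identity and admissible constants *)

Local Notation normc := Normc.normc.

Lemma dotvC (F : finFieldType) n (x y : 'rV[F]_n) : dotv x y = dotv y x.
Proof. by apply: eq_bigr => i _; rewrite mulrC. Qed.

Lemma dotvDl (F : finFieldType) n (x y z : 'rV[F]_n) : dotv (x + y) z = dotv x z + dotv y z.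
Proof. by rewrite /dotv -big_split; apply: eq_bigr => i _; rewrite mxE mulrDl. Qed.

Lemma dotvZl (F : finFieldType) n (t : F) (x z : 'rV[F]_n) : dotv (t *: x) z = t * dotv x z.
Proof. by rewrite /dotv mulr_sumr; apply: eq_bigr => i _; rewrite mxE mulrA. Qed.

Section Fourier.
Variables (R : realType) (F : finFieldType).
Local Notation chi := (@add_char R F).

Lemma normc_ge0 (z : R[i]) : 0 <= normc z.
Proof. by case: z => a b; rewrite /= sqrtr_ge0. Qed.

Lemma normc_real (x : R) : 0 <= x -> normc x%:C%C = x.
Proof. by move=> x0; rewrite /= expr0n addr0 sqrtr_sqr ger0_norm. Qed.

Lemma normc_sum (I : Type) (s : seq I) (P : pred I) (f : I -> R[i]) :
  normc (\sum_(i <- s | P i) f i) <= \sum_(i <- s | P i) normc (f i).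
Proof.
elim/big_rec2: _ => [|i x y _ le]; first by rewrite Normc.normc0.
by apply: le_trans (le_normcD _ _) _; rewrite lerD2l.
Qed.

Lemma plancherel n (f : 'rV[F]_n -> R[i]) :
  \sum_ga normc (\sum_b chi (dotv b ga) * f b) ^+ 2 =
  #|F|%:R ^+ n * \sum_b normc (f b) ^+ 2.
Proof.
apply: complexI; rewrite rmorphM rmorphXn rmorph_nat !rmorph_sum /=.
have N2 (z : R[i]) : ((normc z) ^+ 2)%:C%C = z * z^*%C by rewrite rmorphXn /= -sqr_normc.
have cM (z w : R[i]) : (z * w)^*%C = z^*%C * w^*%C by exact: rmorphM.
under eq_bigr => ga _ do rewrite N2 rmorph_sum mulr_suml.
under [in RHS]eq_bigr => b _ do rewrite N2.
rewrite exchange_big mulr_sumr; apply: eq_bigr => b _ /=.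
under eq_bigr => ga _ do rewrite mulr_sumr.
rewrite exchange_big (bigD1 b) //= [X in _ + X]big1 ?addr0 => [|b' bb].
  rewrite (eq_bigr (fun=> f b * (f b)^*%C)) ?sumr_const ?card_mx ?mul1n -?natrX ?mulr_natl //.
  move=> ga _; rewrite cM add_char_conj mulrACA -add_charD subrr add_char0.
  by rewrite mul1r.
rewrite (eq_bigr (fun ga => chi (dotv ga (b - b')) * (f b * (f b')^*%C))).
  by rewrite -mulr_suml sum_char_dotv subr_eq0 eq_sym (negPf bb) mul0r.
move=> ga _; rewrite cM add_char_conj mulrACA -add_charD; congr (chi _ * _).
by rewrite [in RHS]dotvC dotvDl -scaleN1r dotvZl mulN1r.
Qed.

End Fourier.

Section Norms.
Variables (R : realType) (F : finFieldType) (N : nat).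
Local Notation q := (#|F|%:R : R).

Lemma surf_norm_ge0 (V : {set 'rV[F]_N}) (s : R) (f : 'rV[F]_N -> R[i]) :
  0 <= surf_norm V s%:E f.
Proof. exact: powR_ge0. Qed.

(** Both the characters and the total mass are bounded by 1, so the extension is
    pointwise at most the L^1 norm, hence at most the L^2 norm. *)
Lemma extension_le (V : {set 'rV[F]_N}) (f : 'rV[F]_N -> R[i]) m :
  normc (extension V f m) <= surf_norm V 2%:E f.
Proof.
rewrite /extension Normc.normcM Normc.normcV.
have -> : (#|V|%:R : R[i]) = (#|V|%:R : R)%:C%C by rewrite rmorph_nat.
rewrite normc_real //.
pose w (x : 'rV[F]_N) : R := if x \in V then #|V|%:R^-1 else 0.
have w0 x : 0 <= w x by rewrite /w; case: ifP.
have J := @jensen_powR R _ (fun x => normc (f x)) w 2 _ (fun x => normc_ge0 _) w0.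
apply: (@le_trans _ _ (\sum_x normc (f x) * w x)).
  apply: (le_trans (ler_wpM2l _ (normc_sum _ _ _))); first by rewrite invr_ge0.
  rewrite mulr_sumr big_mkcond; apply: ler_sum => x _; rewrite /w.
  by case: ifP => _; rewrite ?mulr0 // Normc.normcM normc_char mul1r mulrC.
have S0 : 0 <= \sum_x normc (f x) * w x.
  by rewrite sumr_ge0 // => x _; rewrite mulr_ge0 ?normc_ge0.
have T0 : 0 <= #|V|%:R^-1 * \sum_(x in V) normc (f x) `^ 2.
  by rewrite mulr_ge0 ?invr_ge0 // sumr_ge0 // => x _; rewrite powR_ge0.
have -> : \sum_x normc (f x) * w x = ((\sum_x normc (f x) * w x) `^ 2) `^ 2^-1.
  by rewrite -powRrM mulfV // powRr1.
rewrite ge0_ler_powR ?nnegrE ?powR_ge0 ?invr_ge0 //.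
apply: le_trans (J _) _; first by rewrite ler1n.
have W1 : \sum_x w x <= 1.
  rewrite /w -big_mkcond sumr_const.
  have [Vz|Vn] := eqVneq #|V| 0%N; first by rewrite Vz mulr0n ler01.
  by rewrite -[leLHS]mulr_natr mulVf // pnatr_eq0.
have W0 : 0 <= \sum_x w x by exact: sumr_ge0.
rewrite (_ : 2 - 1 = 1 :> R); last by ring.
rewrite powRr1 // (le_trans (ler_wpM2l _ W1)) //.
  by rewrite sumr_ge0 // => x _; rewrite mulr_ge0 ?powR_ge0.
rewrite mulr1 mulr_sumr [leRHS]big_mkcond; apply: ler_sum => x _; rewrite /w.
by case: ifP => _; rewrite ?mulr0 // mulrC.
Qed.

Definition admissible (V : {set 'rV[F]_N}) (p r : \bar R) (C : R) :=
  forall f : 'rV[F]_N -> R[i], count_norm r (extension V f) <= C * surf_norm V p f.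

(** If the admissible constants are unbounded below then [inf] takes its default
    value 0, whence the condition [0 <= C]. *)
Lemma ext_const_le V p r C : 0 <= C -> admissible V p r C -> ext_const V p r <= C.
Proof.
move=> C0 aC; rewrite /ext_const; set A := (X in inf X).
have [lb|nlb] := pselect (has_lbound A); first exact: ge_inf.
by rewrite inf_out // => -[].
Qed.

Lemma admissible_mono V (p : R) r C C' : C <= C' -> admissible V p%:E r C -> admissible V p%:E r C'.
Proof.
by move=> CC aC f; apply: le_trans (aC f) _; rewrite ler_wpM2r // surf_norm_ge0.
Qed.

(** An upper bound on the infimum gives back an estimate, provided that the set of
    admissible constants is known to be nonempty; otherwise the infimum would be
    the default 0. *)
Lemma ext_const_lt V (p : R) r C C' : admissible V p%:E r C -> ext_const V p%:E r < C' ->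
  admissible V p%:E r C'.
Proof.
move=> aC; rewrite /ext_const; set A := (X in inf X) => lt.
suff [C'' aC'' lt''] : exists2 C'', A C'' & C'' < C' by exact: admissible_mono (ltW lt'') aC''.
have A0 : (A !=set0)%classic by exists C.
have [lb|nlb] := pselect (has_lbound A); first exact: inf_lt.
apply: contrapT => h; apply: nlb; exists C' => x Ax; rewrite leNgt; apply/negP => xC.
by apply: h; exists x.
Qed.

(** A constant that depends on the field, good only for the nonemptiness needed
    in [ext_const_lt]. *)
Lemma admissible_real V (r : R) : 0 < r ->
  admissible V 2%:E r%:E (#|{: 'rV[F]_N}|%:R `^ r^-1).
Proof.
move=> r0 f; rewrite /count_norm.
have -> : surf_norm V 2%:E f = ((surf_norm V 2%:E f) `^ r) `^ r^-1.
  by rewrite -powRrM mulfV ?gt_eqF // powRr1 // surf_norm_ge0.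
rewrite -powRM ?powR_ge0 //.
rewrite ge0_ler_powR ?nnegrE ?invr_ge0 ?(ltW r0) //.
- by rewrite sumr_ge0 // => x _; rewrite powR_ge0.
- by rewrite mulr_ge0 ?powR_ge0.
rewrite mulr_natl -sumr_const; apply: ler_sum => m _.
by rewrite ge0_ler_powR ?nnegrE ?(ltW r0) ?normc_ge0 ?surf_norm_ge0 ?extension_le.
Qed.

Lemma admissible_pinfty V : admissible V 2%:E +oo%E 1.
Proof.
move=> f; rewrite mul1r /count_norm; apply: bigmax_le => [|m _]; first exact: surf_norm_ge0.
exact: extension_le.
Qed.

End Norms.

(** * From the paraboloid to the flat disk *)

Section Geometry.
Variables (F : finFieldType) (n : nat).

Notation app a t := (@append n.+1 F a t).

Lemma append_snoc (a : 'rV[F]_n) t i : app a t 0 i = snoc (a 0) t i.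
Proof. by rewrite mxE. Qed.

Definition headv (x : 'rV[F]_n.+1) : 'rV[F]_n := \row_i x 0 (widen_ord (leqnSn n) i).

Lemma headvK x : app (headv x) (x 0 ord_max) = x.
Proof.
apply/rowP => i; rewrite append_snoc; case: (unliftP ord_max i) => [j|] ->; last exact: snoc_max.
rewrite (_ : lift ord_max j = widen_ord (leqnSn n) j); last exact/val_inj/lift_max.
by rewrite snoc_widen mxE.
Qed.

Lemma headv_append (a : 'rV[F]_n) t : headv (app a t) = a.
Proof. by apply/rowP => i; rewrite mxE append_snoc snoc_widen. Qed.

Lemma append_max (a : 'rV[F]_n) t : app a t 0 ord_max = t.
Proof. by rewrite append_snoc snoc_max. Qed.

Lemma dotv_append (a b : 'rV[F]_n) s t : dotv (app a s) (app b t) = dotv a b + s * t.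
Proof.
rewrite /dotv big_ord_recr /= !append_snoc !snoc_max; congr (_ + _).
by apply: eq_bigr => i _; rewrite !append_snoc !snoc_widen.
Qed.

Lemma dotv_row_mx m1 m2 (a c : 'rV[F]_m1) (b d : 'rV[F]_m2) :
  dotv (row_mx a b) (row_mx c d) = dotv a c + dotv b d.
Proof.
rewrite /dotv big_split_ord; congr (_ + _); apply: eq_bigr => i _.
  by rewrite !row_mxEl.
by rewrite !row_mxEr.
Qed.

Lemma sum_append (V : nmodType) (f : 'rV[F]_n.+1 -> V) :
  \sum_m f m = \sum_(a : 'rV[F]_n) \sum_t f (app a t).
Proof.
rewrite pair_big /=; apply: (reindex (fun p : 'rV[F]_n * F => app p.1 p.2)).
exists (fun x => (headv x, x 0 ord_max)) => [[a t]|x] _ /=.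
  by rewrite headv_append append_max.
exact: headvK.
Qed.

Lemma sum_row_mx (V : nmodType) m1 m2 (f : 'rV[F]_(m1 + m2) -> V) :
  \sum_m f m = \sum_a \sum_b f (row_mx a b).
Proof.
rewrite pair_big /=.
apply: (reindex (fun p : 'rV[F]_m1 * 'rV[F]_m2 => row_mx p.1 p.2)).
exists (fun x => (lsubmx x, rsubmx x)) => [[a b]|x] _ /=.
  by rewrite row_mxKl row_mxKr.
exact: hsubmxK.
Qed.

Definition paraboloid_pt (a : 'rV[F]_n) : 'rV[F]_n.+1 := app a (dotv a a).
Definition flat_disk_pt (ab : 'rV[F]_n * 'rV[F]_n) : 'rV[F]_(n.+1 + n.+1) :=
  row_mx (app ab.1 (dotv ab.1 ab.1)) (app ab.2 (dotv ab.1 ab.2)).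

Lemma paraboloid_pt_inj : injective paraboloid_pt.
Proof. by move=> a b /(congr1 headv); rewrite !headv_append. Qed.

Lemma flat_disk_pt_inj : injective flat_disk_pt.
Proof.
move=> [a b] [c d] /eq_row_mx[/(congr1 headv) /= + /(congr1 headv) /=].
by rewrite !headv_append => -> ->.
Qed.

Lemma paraboloidE : paraboloid n.+1 F = [set paraboloid_pt a | a : 'rV[F]_n].
Proof.
have sumE (x : 'rV[F]_n.+1) :
    \sum_(i < n.+1 | (i.+1 < n.+1)%N) x 0 i ^+ 2 = dotv (headv x) (headv x).
  rewrite big_mkcond big_ord_recr /= ltnn addr0.
  by apply: eq_bigr => i _; rewrite ltnS ltn_ord mxE expr2.
apply/setP => x; rewrite inE; apply/forallP/imsetP => [h|[a _ ->] j].
  exists (headv x) => //; rewrite /paraboloid_pt -sumE.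
  by have := h ord_max; rewrite eqxx => /eqP ->; rewrite headvK.
apply/implyP; rewrite eqSS => /eqP jn; have -> : j = ord_max by exact/val_inj.
by rewrite sumE headv_append append_max.
Qed.

Lemma flat_diskE : flat_disk n.+1 F = [set flat_disk_pt ab | ab : 'rV[F]_n * 'rV[F]_n].
Proof.
apply/setP => x; apply/imset2P/imsetP => [[a b _ _ ->]|[[a b] _ ->]].
  by exists (a, b).
by exists a b.
Qed.

End Geometry.

Section Image.
Variables (R : realType) (F : finFieldType) (N : nat) (T : finType) (phi : T -> 'rV[F]_N).
Hypothesis phi_inj : injective phi.

Lemma extension_imset (f : 'rV[F]_N -> R[i]) m :
  extension [set phi a | a : T] f m =
  #|T|%:R^-1 * \sum_a add_char R (dotv (phi a) m) * f (phi a).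
Proof. by rewrite /extension card_imset // big_imset //= => a b _ _; exact: phi_inj. Qed.

Lemma surf_norm_imset (p : R) (f : 'rV[F]_N -> R[i]) :
  surf_norm [set phi a | a : T] p%:E f =
  (#|T|%:R^-1 * \sum_a normc (f (phi a)) `^ p) `^ p^-1.
Proof. by rewrite /surf_norm card_imset // big_imset //= => a b _ _; exact: phi_inj. Qed.

End Image.

Section Main.
Variables (R : realType) (F : finFieldType) (n : nat).
Local Notation q := (#|F|%:R : R).
Local Notation chi := (@add_char R F).
Notation app a t := (@append n.+1 F a t).

Lemma card_row_vectors : (#|{: 'rV[F]_n}|)%N = (#|F| ^ n)%N.
Proof. by rewrite card_mx mul1n. Qed.

(** The Fourier transform, normalized in [b], of [f] on the affine subspace of the
    disk above [a]. *)
Definition fiber (f : 'rV[F]_(n.+1 + n.+1) -> R[i]) (a ga : 'rV[F]_n) : R[i] :=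
  (#|F| ^ n)%N%:R^-1 * \sum_b chi (dotv b ga) * f (flat_disk_pt (a, b)).

(** Summing over the second parameter [b] first: the phase of the disk is
    [a . xi + (a . a) s + b . (eta + t a)], whose last term only enters through
    the Fourier transform in [b] at [eta + t a], and the other two form the phase
    of the paraboloid. *)
Lemma extension_flat_disk f (xi eta : 'rV[F]_n) (s t : F) :
  extension (flat_disk n.+1 F) f (row_mx (app xi s) (app eta t)) =
  extension (paraboloid n.+1 F) (fun x => fiber f (headv x) (eta + t *: headv x)) (app xi s).
Proof.
rewrite flat_diskE paraboloidE !extension_imset;
  [|exact: paraboloid_pt_inj|exact: flat_disk_pt_inj].
rewrite card_prod card_row_vectors natrM invfM -mulrA; congr (_ * _).
rewrite -(pair_bigA _ (fun a b =>
  chi (dotv (flat_disk_pt (a, b)) (row_mx (app xi s) (app eta t))) * f (flat_disk_pt (a, b)))) /=.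
rewrite mulr_sumr; apply: eq_bigr => a _; rewrite /fiber headv_append mulrCA; congr (_ * _).
rewrite mulr_sumr; apply: eq_bigr => b _; rewrite mulrA -add_charD; congr (chi _ * _).
rewrite dotv_row_mx /paraboloid_pt !dotv_append; congr (_ + _).
by rewrite [RHS]dotvC dotvDl dotvZl [dotv eta b]dotvC mulrC.
Qed.

Lemma sum_fiber f (a : 'rV[F]_n) :
  \sum_ga normc (fiber f a ga) `^ 2 = (q ^+ n)^-1 * \sum_b normc (f (flat_disk_pt (a, b))) `^ 2.
Proof.
have qn : q ^+ n != 0 by rewrite expf_neq0 // pnatr_eq0 -lt0n; apply/card_gt0P; exists 0.
under eq_bigr => ga _ do rewrite (powR_mulrn 2) ?normc_ge0 //.
under [in RHS]eq_bigr => b _ do rewrite (powR_mulrn 2) ?normc_ge0 //.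
have cE : ((#|F| ^ n)%N%:R : R[i]) = (q ^+ n)%:C%C by rewrite -natrX rmorph_nat.
under eq_bigr => ga _ do
  rewrite /fiber Normc.normcM Normc.normcV cE normc_real ?exprn_ge0 // exprMn.
by rewrite -mulr_sumr plancherel expr2 -mulrA mulKf.
Qed.

(** The hypothesis on the paraboloid is applied for each [(eta, t)] to the fibers of
    [f] at [eta + t a]. Its right-hand sides add up to the sum in
    [sum_xray_adj_le] with [u = r / 2] and [G] the squared fibers. Since
    [p = 2 v], the outcome is the norm of [f] in L^p after Plancherel and Jensen
    in [b]. *)
Lemma count_norm_flat_disk_le (r C : R) (f : 'rV[F]_(n.+1 + n.+1) -> R[i]) : (0 < n)%N ->
  2 * n.+1%:R / n%:R <= r -> 0 < C ->
  admissible (paraboloid n.+1 F) 2%:E r%:E C ->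
  let p := 2 * r * n%:R / (r * n%:R - 2) in
  count_norm r%:E (extension (flat_disk n.+1 F) f) <=
  C * ((2 ^ n.+1 * kakeya_const n)%N%:R `^ (p / 2 - 1)) `^ p^-1 *
    surf_norm (flat_disk n.+1 F) p%:E f.
Proof.
move=> n0 rn C0 aC; cbv zeta; set p := 2 * r * n%:R / (r * n%:R - 2).
have nR : (0 : R) < n%:R by rewrite ltr0n.
set dK := (2 ^ n.+1 * kakeya_const n)%N%:R.
pose G (a ga : 'rV[F]_n) := normc (fiber f a ga) `^ 2.
have G0 a ga : 0 <= G a ga by exact: powR_ge0.
pose u := r / 2.
have r2n : 2 * n.+1%:R <= r * n%:R by rewrite -ler_pdivrMr.
have un : n.+1%:R / n%:R <= u by rewrite /u ler_pdivrMr // mulrAC ler_pdivlMr // mulrC.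
have r0 : 0 < r by apply: lt_le_trans rn; rewrite divr_gt0 // mulr_gt0 // ltr0n.
have rn2 : 0 < r * n%:R - 2.
  rewrite subr_gt0; apply: lt_le_trans r2n; rewrite -[ltLHS]mulr1 ltr_pM2l // ltr1n //.
have p0 : 0 < p by rewrite divr_gt0 // !mulr_gt0.
pose v := u * n%:R / (u * n%:R - 1).
have vp : v = p / 2.
  have h : r * n%:R - 2 != 0 by rewrite gt_eqF.
  by rewrite /v /p /u; field; rewrite h //=; apply: contraNneq h => h; rewrite -h; apply/eqP; ring.
pose S := \sum_y \sum_t (xray_adj G y t) `^ u.
have key : \sum_m normc (extension (flat_disk n.+1 F) f m) `^ r <= C `^ r * S.
  rewrite sum_row_mx exchange_big sum_append /= mulr_sumr; apply: ler_sum => eta _.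
  rewrite mulr_sumr; apply: ler_sum => t _.
  pose g x := fiber f (headv x) (eta + t *: headv x).
  rewrite (eq_bigr (fun m => normc (extension (paraboloid n.+1 F) g m) `^ r)); last first.
    by move=> m _; rewrite -(headvK m) extension_flat_disk.
  have := aC g; rewrite /count_norm => H.
  have A0 : 0 <= \sum_m normc (extension (paraboloid n.+1 F) g m) `^ r.
    by rewrite sumr_ge0 // => x _; exact: powR_ge0.
  have := @ge0_ler_powR R r (ltW r0) _ _ _ _ H.
  rewrite !nnegrE powR_ge0 mulr_ge0 ?surf_norm_ge0 ?(ltW C0) // => /(_ isT isT).
  rewrite -powRrM mulVf ?gt_eqF // powRr1 // => /le_trans; apply.
  rewrite powRM ?surf_norm_ge0 ?(ltW C0) // ler_wpM2l ?powR_ge0 //.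
  rewrite paraboloidE surf_norm_imset; last exact: paraboloid_pt_inj.
  rewrite card_row_vectors -powRrM (_ : 2^-1 * r = u); last by rewrite mulrC.
  have -> : \sum_a normc (g (paraboloid_pt a)) `^ 2 = \sum_a G a (eta + t *: a).
    by apply: eq_bigr => a _; rewrite /g /paraboloid_pt headv_append.
  rewrite natrX; exact: lexx.
have S0 : 0 <= S.
  by rewrite sumr_ge0 // => y _; rewrite sumr_ge0 // => t _; exact: powR_ge0.
have X := sum_xray_adj_le n0 G0 un; rewrite -/S -/v -/dK in X.
have q0 : 0 < q by rewrite ltr0n; apply/card_gt0P; exists 0.
have qn0 : 0 < q ^+ n by rewrite exprn_gt0.
have v1 : 1 <= v.
  rewrite vp ler_pdivlMr // mul1r /p ler_pdivlMr // mulrBr.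
  by rewrite mulrA gerBl.
pose N2 := (#|{: 'rV[F]_n * 'rV[F]_n}|%:R)^-1 * \sum_ab normc (f (flat_disk_pt ab)) `^ p.
have N20 : 0 <= N2 by rewrite mulr_ge0 ?invr_ge0 // sumr_ge0 // => x _; exact: powR_ge0.
have AN : (q ^+ n)^-1 * \sum_al (\sum_ga G al ga) `^ v <= N2.
  rewrite /N2 card_prod card_row_vectors natrM natrX invfM -mulrA ler_wpM2l ?invr_ge0 ?(ltW qn0) //.
  rewrite -(pair_bigA _ (fun a b => normc (f (flat_disk_pt (a, b))) `^ p)) /= mulr_sumr.
  apply: ler_sum => a _; rewrite sum_fiber.
  have W : \sum_(b : 'rV[F]_n) (q ^+ n)^-1 = 1.
    by rewrite sumr_const card_row_vectors -[LHS]mulr_natl natrX mulfV ?gt_eqF.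
  have c0 : 0 <= (q ^+ n)^-1 by rewrite invr_ge0 ltW.
  have J := @jensen_powR R _ (fun b => normc (f (flat_disk_pt (a, b))) `^ 2)
    (fun=> (q ^+ n)^-1) v v1
    (fun b => powR_ge0 _ _) (fun b => c0).
  rewrite W powR1 mulr1 -!mulr_suml in J.
  rewrite mulrC; apply: (le_trans J).
  rewrite mulrC (eq_bigr (fun b => normc (f (flat_disk_pt (a, b))) `^ p)) // => b _.
  by rewrite -powRrM vp mulrC divfK.
rewrite {1}/count_norm flat_diskE surf_norm_imset; last exact: flat_disk_pt_inj.
rewrite -flat_diskE -/N2.
apply: (@le_trans _ _ ((C `^ r * S) `^ r^-1)).
  rewrite ge0_ler_powR ?nnegrE ?invr_ge0 ?(ltW r0) //.
    by rewrite sumr_ge0 // => x _; exact: powR_ge0.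
  by rewrite mulr_ge0 ?powR_ge0.
rewrite powRM ?powR_ge0 // -powRrM mulfV ?gt_eqF // powRr1 ?(ltW C0) // -mulrA.
rewrite ler_wpM2l ?(ltW C0) // -powRM ?powR_ge0 //.
have -> : S `^ r^-1 = (S `^ (v / u)) `^ p^-1.
  rewrite -powRrM; congr (_ `^ _); rewrite vp /u; field.
  by rewrite ?gt_eqF.
rewrite ge0_ler_powR ?nnegrE ?invr_ge0 ?powR_ge0 ?(ltW p0) //.
  by rewrite mulr_ge0 ?powR_ge0.
by rewrite -vp; apply: (le_trans X); rewrite ler_wpM2l ?powR_ge0.
Qed.

End Main.

Theorem proposition5p1 (R : realType) (d : nat) (r : \bar R) :
  (2 <= d)%N ->
  ((2 * d%:R / (d%:R - 1))%:E <= r)%E ->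
  lesssim (fun F : finFieldType => ext_const (paraboloid d F) 2%:E r)
          (fun _ => 1) ->
  lesssim (fun F : finFieldType => ext_const (flat_disk d F) (disk_exponent d r) r)
          (fun _ => 1).
Proof.
case: d => // n; rewrite ltnS => n0.
have -> : (n.+1%:R - 1 : R) = n%:R by rewrite -natr1 addrK.
case: r => [r| |] //; last first.
  move=> _ _; exists 1 => // F _; rewrite mulr1.
  exact: ext_const_le (admissible_pinfty _).
rewrite lee_fin => rn [C C0 HC].
have r0 : 0 < r by apply: lt_le_trans rn; rewrite divr_gt0 ?mulr_gt0 ?ltr0n.
pose p := 2 * r * n%:R / (r * n%:R - 2).
exists ((C + 1) * ((2 ^ n.+1 * kakeya_const n)%N%:R `^ (p / 2 - 1)) `^ p^-1).
  rewrite mulr_gt0 ?addr_gt0 // !powR_gt0 // ltr0n /kakeya_const.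
  by rewrite !muln_gt0 !expn_gt0 /= muln_gt0 n0.
move=> F oddF; rewrite mulr1.
have -> : disk_exponent n.+1 r%:E = p%:E.
  rewrite /disk_exponent /p; congr EFin.
  by rewrite -natr1; congr (_ * _^-1); ring.
have C1 : 0 < C + 1 by rewrite addr_gt0.
apply: ext_const_le; first by rewrite mulr_ge0 ?powR_ge0 ?(ltW C1).
move=> f; apply: count_norm_flat_disk_le => //.
apply: ext_const_lt (admissible_real _ r0) _.
by apply: le_lt_trans (HC F oddF) _; rewrite mulr1 ltrDl.
Qed.
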